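(* Let $\varepsilon > 0$. Suppose there is an algorithm that, given two sequences of length $n$ over a linearly ordered alphabet, computes the length of their Longest Common Weakly Increasing Subsequence in $O(n^{2-\varepsilon})$ time. Then there is an algorithm that, given a CNF formula on $N$ variables and $M$ clauses, computes the maximum number of clauses that can be simultaneously satisfied by an assignment to the variables (MAX-CNF-SAT) in $O(2^{(1-\varepsilon/2)N}\,\mathrm{poly}(M))$ time.
   Context: Longest Common Weakly Increasing Subsequence (LCWIS): given two sequences $A$ and $B$ over an alphabet $\Sigma$ with a linear order $\le_\Sigma$, find a sequence $C$ that is weakly increasing with respect to $\le_\Sigma$, is a subsequence of both $A$ and $B$, and has maximum possible length; $\mathrm{LCWIS}(A,B)$ denotes this maximum length. *)

(* Defs.v *)
From HB Require Import structures.
From mathcomp Require Import all_boot all_order all_algebra.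
From mathcomp Require Import all_classical all_reals all_analysis.

Set Implicit Arguments.
Unset Strict Implicit.
Unset Printing Implicit Defensive.

Import Order.TTheory GRing.Theory Num.Theory.
Import numFieldNormedType.Exports.

Local Open Scope nat_scope.

(** * Word RAM

    The model of computation is the word RAM: finitely many registers (those
    named in the program) and a random access memory, both holding natural
    numbers of [w] bits.  Programs are structured; since a program has a fixed
    size, a program with jumps can be turned into a structured one with a
    constant factor slowdown, by keeping the program counter in a register. *)

Inductive binop :=
  | OpAdd | OpSub | OpMul | OpDiv | OpMod
  | OpAnd | OpOr | OpXor | OpShl | OpShr
  | OpEq | OpLt.

(* Subtraction is truncated at 0, and division by 0 is total: [m %/ 0 = 0],
   [m %% 0 = m]. *)
Definition eval_binop (o : binop) (m n : nat) : nat :=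
  match o with
  | OpAdd => m + n
  | OpSub => m - n
  | OpMul => m * n
  | OpDiv => m %/ n
  | OpMod => m %% n
  | OpAnd => Nat.land m n
  | OpOr  => Nat.lor m n
  | OpXor => Nat.lxor m n
  | OpShl => Nat.shiftl m n
  | OpShr => Nat.shiftr m n
  | OpEq  => m == n
  | OpLt  => m < n
  end.

Inductive cmd :=
  | Skip
  | Const of nat & nat              (* r_x := v *)
  | Op of binop & nat & nat & nat   (* r_x := r_y o r_z *)
  | ReadMem of nat & nat            (* r_x := mem[r_y] *)
  | WriteMem of nat & nat           (* mem[r_x] := r_y *)
  | Seq of cmd & cmd
  | If of nat & cmd & cmd           (* if r_x <> 0 then _ else _ *)
  | While of nat & cmd.             (* while r_x <> 0 do _ *)

Record state := State { regs : nat -> nat; mem : nat -> nat }.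

Definition upd (f : nat -> nat) (x v : nat) : nat -> nat :=
  fun y => if y == x then v else f y.

Definition set_reg (s : state) (x v : nat) : state :=
  State (upd (regs s) x v) (mem s).

Definition set_mem (s : state) (a v : nat) : state :=
  State (regs s) (upd (mem s) a v).

(* [exec w p s t s'] : on the RAM with [w]-bit words, [p] started in [s] halts
   in [s'] after exactly [t] steps, every elementary instruction and every test
   being one step.  Overflow is an error: there is no execution in which a
   register would receive a value that does not fit in a word. *)
Inductive exec (w : nat) : cmd -> state -> nat -> state -> Prop :=
  | ExecSkip s : exec w Skip s 0 s
  | ExecConst x v s :
      v < 2 ^ w ->
      exec w (Const x v) s 1 (set_reg s x v)
  | ExecOp o x y z s :
      eval_binop o (regs s y) (regs s z) < 2 ^ w ->
      exec w (Op o x y z) s 1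
        (set_reg s x (eval_binop o (regs s y) (regs s z)))
  | ExecReadMem x y s :
      mem s (regs s y) < 2 ^ w ->
      exec w (ReadMem x y) s 1 (set_reg s x (mem s (regs s y)))
  | ExecWriteMem x y s :
      exec w (WriteMem x y) s 1 (set_mem s (regs s x) (regs s y))
  | ExecSeq p q s s1 s2 t1 t2 :
      exec w p s t1 s1 -> exec w q s1 t2 s2 ->
      exec w (Seq p q) s (t1 + t2) s2
  | ExecIfTrue x p q s s1 t :
      regs s x <> 0 -> exec w p s t s1 ->
      exec w (If x p q) s t.+1 s1
  | ExecIfFalse x p q s s1 t :
      regs s x = 0 -> exec w q s t s1 ->
      exec w (If x p q) s t.+1 s1
  | ExecWhileTrue x p s s1 s2 t1 t2 :
      regs s x <> 0 -> exec w p s t1 s1 -> exec w (While x p) s1 t2 s2 ->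
      exec w (While x p) s (t1 + t2).+1 s2
  | ExecWhileFalse x p s :
      regs s x = 0 -> exec w (While x p) s 1 s.

(* The input occupies the first memory cells; everything else is initially 0. *)
Definition init_state (input : seq nat) : state :=
  State (fun _ => 0) (nth 0 input).

(* The output is read from register 0. *)
Definition outputs (w : nat) (p : cmd) (input : seq nat) (t out : nat) : Prop :=
  exists2 s, exec w p (init_state input) t s & regs s 0 = out.

(** * Longest common weakly increasing subsequences *)

Definition common_wis (d : Order.disp_t) (T : orderType d) (A B C : seq T) :
    Prop :=
  [/\ sorted <=%O C, subseq C A & subseq C B].

Definition is_LCWIS_length (d : Order.disp_t) (T : orderType d) (A B : seq T)
    (k : nat) : Prop :=
  (exists2 C, common_wis A B C & size C = k) /\
  (forall C, common_wis A B C -> size C <= k).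

Definition encode_LCWIS (A B : seq nat) : seq nat := size A :: A ++ B.

(* The symbols of the alphabet are natural numbers, compared by their usual
   order.  Words have O(log n + log s) bits, where s is the largest symbol. *)
Definition LCWIS_word (c n : nat) (A B : seq nat) : nat :=
  c * (trunc_log 2 (n + \max_(x <- A ++ B) x)).+1.

Definition LCWIS_algorithm (R : realType) (T : nat -> R) : Prop :=
  exists (p : cmd) (c : nat), forall (n : nat) (A B : seq nat),
    size A = n -> size B = n ->
    exists t k : nat,
      [/\ outputs (LCWIS_word c n A B) p (encode_LCWIS A B) t k,
          is_LCWIS_length A B k
        & (t%:R <= T n)%R].

(** * MAX-CNF-SAT *)

(* [(i, b)] is the literal satisfied by giving variable [i] the value [b]. *)
Definition literal (N : nat) : Type := ('I_N * bool)%type.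
Definition clause (N : nat) : Type := seq (literal N).
Definition cnf (N : nat) : Type := seq (clause N).

(* A clause is a set of literals, written as a list without repetition; in
   particular it has at most 2N literals.  Clauses themselves may be repeated. *)
Definition wf_cnf (N : nat) (F : cnf N) : bool :=
  all (fun c : seq ('I_N * bool) => uniq c) F.

Definition sat_clause (N : nat) (a : {ffun 'I_N -> bool}) (c : clause N) : bool :=
  has (fun l : literal N => a l.1 == l.2) c.

Definition max_sat (N : nat) (F : cnf N) : nat :=
  \max_(a : {ffun 'I_N -> bool}) count (sat_clause a) F.

Definition encode_literal (N : nat) (l : literal N) : nat := 2 * l.1 + l.2.

Definition encode_clause (N : nat) (c : clause N) : seq nat :=
  size c :: map (@encode_literal N) c.

Definition encode_cnf (N : nat) (F : cnf N) : seq nat :=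
  N :: size F :: flatten (map (@encode_clause N) F).

(* Words have O(N + log M) bits, as is needed to address a memory of size
   exponential in N and polynomial in M. *)
Definition max_sat_word (c N M : nat) : nat := c * (N + trunc_log 2 M).+1.

Definition MAX_CNF_SAT_algorithm (R : realType) (T : nat -> nat -> R) : Prop :=
  exists (p : cmd) (c : nat), forall (N M : nat) (F : cnf N),
    wf_cnf F -> size F = M ->
    exists t : nat,
      outputs (max_sat_word c N M) p (encode_cnf F) t (max_sat F) /\
      (t%:R <= T N M)%R.

(* Main.v *)
Require Import Defs.
From HB Require Import structures.
From mathcomp Require Import all_boot all_order all_algebra.
From mathcomp Require Import all_classical all_reals all_analysis.
From mathcomp Require Import zify ring lra.
From Stdlib Require PeanoNat.

Import Order.TTheory GRing.Theory Num.Theory.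

Import numFieldNormedType.Exports.
Import Defs.

Set Implicit Arguments.
Unset Strict Implicit.
Unset Printing Implicit Defensive.

(** If [eps > 1] the hypothesis is contradictory: an algorithm that runs in sublinear
    time leaves some cell of the input [1^n], [1^n] unread.

    For [eps <= 1] split the variables into two halves and represent each half
    assignment by the set of clauses it satisfies; [max_sat] is the maximum, over
    pairs of rows [i] and [j], of the number of clauses satisfied by row [i] of the
    first half or row [j] of the second.  Both LCWIS sequences are concatenations
    of [2 ^ k] blocks, one for each row, each block being weakly increasing.  The
    middle symbols of blocks [i] and [j] have a common subsequence of length twice
    the number of clauses satisfied by the pair [(i, j)].  The small symbols form
    [k] levels, the level of weight [2 ^ r] occurring only in blocks whose index is
    a multiple of [2 ^ r]: with [W] the multiplicity of a run of weight 1, the LCWIS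
    of the small symbols up to blocks [i] and [j] has length exactly [W * (i + j)],
    one unit for each binary digit of [i] and [j].  The large symbols are the mirror
    image, so that small and large symbols together contribute the constant
    [2 * W * (2 ^ k - 1)] when the middle symbols come from a single pair [(i, j)],
    and for [W] large compared with the length of the middle part it does not pay to
    use several pairs.  The separators cost a factor [k]; taking [k] at most the
    number of clauses, by merging half assignments that satisfy the same clauses,
    makes this polynomial in [M].

    The word RAM program packs the literals of a clause into two words, so that
    testing a half assignment against a clause takes constant time, and runs the
    LCWIS program with all of its memory addresses shifted past its own data. *)

Local Open Scope nat_scope.

(** * Executions of word RAM programs *)

Lemma exec_deterministic w p s t1 s1 : exec w p s t1 s1 ->
  forall t2 s2, exec w p s t2 s2 -> t1 = t2 /\ s1 = s2.
Proof.
elim=> {p s t1 s1}; try by intros; match goal with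
  E : exec _ _ _ _ _ |- _ => inversion E end.
- move=> p q s s1 s2 t1 t2 _ IHp _ IHq t s' E.
  inversion E as [| | | | |? ? ? u ? t1' t2' Ep Eq| | | |]; subst.
  by have [-> eq_s1] := IHp _ _ Ep; have [-> ->] := IHq _ _ ltac:(rewrite eq_s1; exact: Eq).
- move=> x p q s s1 t nz _ IH t' s' E.
  inversion E as [| | | | | |? ? ? ? ? ? _ Ep| | |]; subst=> //.
  by have [-> ->] := IH _ _ Ep.
- move=> x p q s s1 t z _ IH t' s' E.
  inversion E as [| | | | | | |? ? ? ? ? ? _ Eq| |]; subst=> //.
  by have [-> ->] := IH _ _ Eq.
- move=> x p s s1 s2 t1 t2 nz _ IHp _ IHw t s' E.
  inversion E as [| | | | | | | |? ? ? u ? t1' t2' _ Ep Ew|]; subst=> //.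
  by have [-> eq_s1] := IHp _ _ Ep; have [-> ->] := IHw _ _ ltac:(rewrite eq_s1; exact: Ew).
Qed.

(* [E] still takes the registers of [s] to those of [s'] when the memory is changed
   outside of [S], and then cells that were not changed also agree at the end. *)
Definition local_run (E : state -> state -> Prop) (s s' : state) (S : seq nat) : Prop :=
  forall m, {in S, m =1 mem s} ->
  exists2 m', E (State (regs s) m) (State (regs s') m') &
    forall a, m a = mem s a -> m' a = mem s' a.

Lemma local_run_comp (E1 E2 E : state -> state -> Prop) s s1 s2 S1 S2 :
  (forall m u1 u2, E1 (State (regs s) m) u1 -> E2 u1 u2 -> E (State (regs s) m) u2) ->
  local_run E1 s s1 S1 -> local_run E2 s1 s2 S2 -> local_run E s s2 (S1 ++ S2).
Proof.
move=> compE run1 run2 m agree.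
have [a S1a|m1 Em1 agree1] := run1 m; first by apply: agree; rewrite mem_cat S1a.
have [a S2a|m2 Em2 agree2] := run2 m1.
  by apply/agree1/agree; rewrite mem_cat S2a orbT.
by exists m2 => [|a /agree1/agree2//]; apply: compE Em1 Em2.
Qed.

Lemma local_run_impl (E E' : state -> state -> Prop) s s' S :
  (forall m u, E (State (regs s) m) u -> E' (State (regs s) m) u) ->
  local_run E s s' S -> local_run E' s s' S.
Proof. by move=> EE' run m /run[m' /EE' E'm' agree]; exists m'. Qed.

Lemma exec_local w p s t s' : exec w p s t s' ->
  exists2 S : seq nat, size S <= t & local_run (fun u u' => exec w p u t u') s s' S.
Proof.
elim=> {p s t s'}.
- by move=> s; exists [::] => // m _; exists m => //; apply: ExecSkip.
- move=> x v s lt_v; exists [::] => // m _; exists m => //.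
  exact: (ExecConst x (State (regs s) m)).
- move=> o x y z s lt_v; exists [::] => // m _; exists m => //.
  exact: (ExecOp (s := State (regs s) m) x).
- move=> x y s lt_v; exists [:: regs s y] => // m agree; exists m => //.
  have read_same : m (regs s y) = mem s (regs s y) by rewrite agree ?mem_head.
  by rewrite -read_same in lt_v *; apply: (ExecReadMem (s := State (regs s) m) x).
- move=> x y s; exists [::] => // m _; exists (upd m (regs s x) (regs s y)).
    exact: (ExecWriteMem w x y (State (regs s) m)).
  by move=> a; rewrite /= /upd; case: ifP.
- move=> p q s s1 s2 t1 t2 _ [S1 le_S1 run1] _ [S2 le_S2 run2].
  exists (S1 ++ S2); first by rewrite size_cat leq_add.
  by apply: local_run_comp run1 run2 => m u1 u2; apply: ExecSeq.
- move=> x p q s s1 t nz _ [S le_S run]; exists S; first exact: leqW.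
  by apply: local_run_impl run => m u; apply: ExecIfTrue.
- move=> x p q s s1 t z _ [S le_S run]; exists S; first exact: leqW.
  by apply: local_run_impl run => m u; apply: ExecIfFalse.
- move=> x p s s1 s2 t1 t2 nz _ [S1 le_S1 run1] _ [S2 le_S2 run2].
  exists (S1 ++ S2); first by rewrite size_cat leqW // leq_add.
  by apply: local_run_comp run1 run2 => m u1 u2; apply: ExecWhileTrue.
- by move=> x p s z; exists [::] => // m _; exists m => //; apply: ExecWhileFalse.
Qed.

Lemma upd_same f x v : upd f x v x = v.
Proof. by rewrite /upd eqxx. Qed.

Lemma upd_other f x v y : y != x -> upd f x v y = f y.
Proof. by rewrite /upd => /negbTE ->. Qed.

Fixpoint max_reg (p : cmd) : nat :=
  match p with
  | Skip => 0
  | Const x _ => x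
  | Op _ x y z => maxn x (maxn y z)
  | ReadMem x y | WriteMem x y => maxn x y
  | Seq p q => maxn (max_reg p) (max_reg q)
  | If x p q => maxn x (maxn (max_reg p) (max_reg q))
  | While x p => maxn x (max_reg p)
  end.

(* All memory addresses are shifted by the content of register [rb]; register [rt]
   is scratch. *)
Fixpoint relocate (rb rt : nat) (p : cmd) : cmd :=
  match p with
  | ReadMem x y => Seq (Op OpAdd rt y rb) (ReadMem x rt)
  | WriteMem x y => Seq (Op OpAdd rt x rb) (WriteMem rt y)
  | Seq p q => Seq (relocate rb rt p) (relocate rb rt q)
  | If x p q => If x (relocate rb rt p) (relocate rb rt q)
  | While x p => While x (relocate rb rt p)
  | p => p
  end.

Section Relocation.
Variables (w w' K base rb rt : nat).
Hypothesis room : 2 ^ w + base <= 2 ^ w'.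
Hypotheses (le_Krb : K <= rb) (le_Krt : K <= rt) (rb_rt : rb != rt).

Definition relocated (s u : state) : Prop :=
  [/\ forall r, r < K -> regs u r = regs s r,
      forall a, mem u (base + a) = mem s a,
      regs u rb = base & forall r, regs s r < 2 ^ w].

Definition simulates (q : cmd) (u : state) (t : nat) (s' : state) : Prop :=
  exists t' u', [/\ exec w' q u t' u', t' <= 2 * t, relocated s' u' &
    forall r, K <= r -> r != rt -> regs u' r = regs u r].

Let fits_word v : v < 2 ^ w -> v < 2 ^ w'. Proof. by move: room; lia. Qed.

Lemma relocated_set_reg s u x v : x < K -> v < 2 ^ w ->
  relocated s u -> relocated (set_reg s x v) (set_reg u x v).
Proof.
move=> ltx ltv [Ru Mu bu lts]; split=> //=.
- by move=> r lt_r; rewrite /upd; case: ifP => // _; apply: Ru.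
- by rewrite upd_other //; lia.
- by move=> r; rewrite /upd; case: ifP.
Qed.

Lemma relocated_scratch s u v : relocated s u -> relocated s (set_reg u rt v).
Proof.
case=> Ru Mu bu lts; split=> //=; last by rewrite upd_other.
by move=> r lt_r; rewrite upd_other; [apply: Ru | lia].
Qed.

Lemma simulates_assign q s u x v : x < K -> v < 2 ^ w -> relocated s u ->
  exec w' q u 1 (set_reg u x v) -> simulates q u 1 (set_reg s x v).
Proof.
move=> ltx ltv su E; exists 1, (set_reg u x v); split=> //.
  exact: relocated_set_reg.
by move=> r le_r _; rewrite /= upd_other //; lia.
Qed.

Lemma exec_address s u y : y < K -> relocated s u ->
  exec w' (Op OpAdd rt y rb) u 1 (set_reg u rt (base + regs s y)).
Proof.
move=> lty [Ru _ bu lts].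
have := ExecOp (w := w') (o := OpAdd) rt (y := y) (z := rb) (s := u).
by rewrite /= Ru // bu addnC; apply; have := lts y; lia.
Qed.

Lemma simulates_read s u x y : x < K -> y < K -> mem s (regs s y) < 2 ^ w ->
  relocated s u ->
  simulates (relocate rb rt (ReadMem x y)) u 1 (set_reg s x (mem s (regs s y))).
Proof.
move=> ltx lty ltv su; have [_ Mu _ _] := su.
set u1 := set_reg u rt (base + regs s y).
have read : mem u1 (regs u1 rt) = mem s (regs s y) by rewrite /= upd_same Mu.
exists (1 + 1), (set_reg u1 x (mem s (regs s y))); split=> //.
- apply: ExecSeq (exec_address lty su) _.
  have := ExecReadMem (w := w') x (y := rt) (s := u1).
  by rewrite read; apply; apply: fits_word.
- exact/relocated_set_reg/relocated_scratch.
- by move=> r le_r r_rt; rewrite /= !upd_other //; lia.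
Qed.

Lemma simulates_write s u x y : x < K -> y < K -> relocated s u ->
  simulates (relocate rb rt (WriteMem x y)) u 1 (set_mem s (regs s x) (regs s y)).
Proof.
move=> ltx lty su; set u1 := set_reg u rt (base + regs s x).
have [R1 M1 b1 lts] : relocated s u1 by apply: relocated_scratch.
have address : regs u1 rt = base + regs s x by apply: upd_same.
exists (1 + 1), (set_mem u1 (regs u1 rt) (regs u1 y)); split=> //.
- exact: ExecSeq (exec_address ltx su) (ExecWriteMem _ _ _ _).
- split=> // a; rewrite address R1 //= /upd eqn_add2l.
  by case: ifP => // _; apply: M1.
- by move=> r le_r r_rt; rewrite /= upd_other.
Qed.

Lemma exec_relocate p s t s' : exec w p s t s' -> max_reg p < K ->
  forall u, relocated s u -> simulates (relocate rb rt p) u t s'.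
Proof.
elim=> {p s t s'} /=.
- by move=> s _ u su; exists 0, u; split=> //; apply: ExecSkip.
- move=> x v s ltv ltx u su; apply: simulates_assign => //.
  exact/ExecConst/fits_word.
- move=> o x y z s ltv; rewrite !gtn_max => /and3P[ltx lty ltz] u su.
  have [Ru _ _ _] := su; apply: simulates_assign => //.
  by rewrite -!Ru // in ltv *; apply/ExecOp/fits_word.
- by move=> x y s ltv; rewrite gtn_max => /andP[ltx lty] u; apply: simulates_read.
- by move=> x y s; rewrite gtn_max => /andP[ltx lty] u; apply: simulates_write.
- move=> p q s s1 s2 t1 t2 _ IHp _ IHq; rewrite gtn_max => /andP[ltp ltq] u su.
  have [t1' [u1 [E1 le_t1 su1 fr1]]] := IHp ltp u su.
  have [t2' [u2 [E2 le_t2 su2 fr2]]] := IHq ltq u1 su1.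
  exists (t1' + t2'), u2; split=> //; [exact: ExecSeq E1 E2 | by lia |].
  by move=> r le_r r_rt; rewrite fr2 ?fr1.
- move=> x p q s s1 t nz _ IH; rewrite !gtn_max => /and3P[ltx ltp _] u su.
  have [Ru _ _ _] := su; have [t' [u' [E le_t su' fr]]] := IH ltp u su.
  by exists t'.+1, u'; split=> //; [apply: ExecIfTrue; rewrite ?Ru | lia].
- move=> x p q s s1 t z _ IH; rewrite !gtn_max => /and3P[ltx _ ltq] u su.
  have [Ru _ _ _] := su; have [t' [u' [E le_t su' fr]]] := IH ltq u su.
  by exists t'.+1, u'; split=> //; [apply: ExecIfFalse; rewrite ?Ru | lia].
- move=> x p s s1 s2 t1 t2 nz _ IHp _ IHw lt_reg u su.
  have /andP[ltx ltp] : (x < K) && (max_reg p < K) by rewrite -gtn_max.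
  have [Ru _ _ _] := su; have [t1' [u1 [E1 le_t1 su1 fr1]]] := IHp ltp u su.
  have [t2' [u2 [E2 le_t2 su2 fr2]]] := IHw lt_reg u1 su1.
  exists (t1' + t2').+1, u2; split=> //; [|by lia|].
    by apply: ExecWhileTrue E1 E2; rewrite Ru.
  by move=> r le_r r_rt; rewrite fr2 ?fr1.
- move=> x p s z; rewrite gtn_max => /andP[ltx _] u su; have [Ru _ _ _] := su.
  by exists 1, u; split=> //; apply: ExecWhileFalse; rewrite Ru.
Qed.

End Relocation.

(** * Binary digits *)

Lemma powE a n : Nat.pow a n = a ^ n.
Proof. by elim: n => //= n ->; rewrite expnS. Qed.

Lemma shiftlE a n : Nat.shiftl a n = a * 2 ^ n.
Proof. by rewrite PeanoNat.Nat.shiftl_mul_pow2 powE. Qed.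

Lemma testbitE a n : Nat.testbit a n = odd (a %/ 2 ^ n).
Proof.
have oddE b : Nat.odd b = odd b.
  by elim: b => // b IH; rewrite PeanoNat.Nat.odd_succ -PeanoNat.Nat.negb_odd IH.
have div2E b : Nat.div2 b = b %/ 2.
  by have := PeanoNat.Nat.div2_odd b; rewrite oddE; case: odd => /=; lia.
elim: n a => [|n IH] a; first by rewrite divn1 -oddE.
by rewrite /= IH div2E -divnMA expnS.
Qed.

Lemma testbit_inhabited a : a <> 0 -> exists n, Nat.testbit a n.
Proof. by move=> nz; exists (PeanoNat.Nat.log2 a); apply: PeanoNat.Nat.bit_log2. Qed.

Lemma ltn_exp2_testbit a n :
  a < 2 ^ n <-> forall i, n <= i -> Nat.testbit a i = false.
Proof.
split=> [lt_a i le_ni|high_bits].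
  by rewrite testbitE divn_small //; apply: leq_trans lt_a _; rewrite leq_exp2l.
rewrite -[2 ^ n]mul1n -ltn_divLR ?expn_gt0 // ltnS leqn0; apply/eqP.
apply: contrapT => /testbit_inhabited[i].
by rewrite testbitE -divnMA -expnD -testbitE high_bits ?leq_addr.
Qed.

Lemma land_lt a b n : a < 2 ^ n -> Nat.land a b < 2 ^ n.
Proof.
move=> /ltn_exp2_testbit high_a; apply/ltn_exp2_testbit => i le_ni.
by rewrite PeanoNat.Nat.land_spec high_a.
Qed.

Lemma lor_lt a b n : a < 2 ^ n -> b < 2 ^ n -> Nat.lor a b < 2 ^ n.
Proof.
move=> /ltn_exp2_testbit high_a /ltn_exp2_testbit high_b; apply/ltn_exp2_testbit => i le_ni.
by rewrite PeanoNat.Nat.lor_spec high_a ?high_b.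
Qed.

Lemma lxor_lt a b n : a < 2 ^ n -> b < 2 ^ n -> Nat.lxor a b < 2 ^ n.
Proof.
move=> /ltn_exp2_testbit high_a /ltn_exp2_testbit high_b; apply/ltn_exp2_testbit => i le_ni.
by rewrite PeanoNat.Nat.lxor_spec high_a ?high_b.
Qed.

Lemma shiftr_lt a b n : a < 2 ^ n -> Nat.shiftr a b < 2 ^ n.
Proof.
move=> /ltn_exp2_testbit high_a; apply/ltn_exp2_testbit => i le_ni.
by rewrite PeanoNat.Nat.shiftr_spec' high_a // (leq_trans le_ni) ?leq_addr.
Qed.

Lemma testbit_shiftl a n i :
  Nat.testbit (Nat.shiftl a n) i = (n <= i) && Nat.testbit a (i - n).
Proof.
have [le_ni|lt_in] := leqP n i; last exact/PeanoNat.Nat.shiftl_spec_low/ssrnat.ltP.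
exact/PeanoNat.Nat.shiftl_spec_high'/ssrnat.leP.
Qed.

Lemma testbit_shiftl1 n i : Nat.testbit (Nat.shiftl 1 n) i = (n == i).
Proof.
rewrite PeanoNat.Nat.shiftl_1_l PeanoNat.Nat.pow2_bits_eqb.
by case: (PeanoNat.Nat.eqb_spec n i) => [->|/eqP/negbTE->]; rewrite ?eqxx.
Qed.

Lemma testbit_ones n i : Nat.testbit (2 ^ n - 1) i = (i < n).
Proof.
have -> : 2 ^ n - 1 = PeanoNat.Nat.ones n.
  by rewrite PeanoNat.Nat.ones_equiv powE subn1.
have [lt_in|le_ni] := ltnP i n.
  exact/PeanoNat.Nat.ones_spec_low/ssrnat.ltP.
exact/PeanoNat.Nat.ones_spec_high/ssrnat.leP.
Qed.

Lemma sum_binary_digits n x : x < 2 ^ n ->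
  \sum_(0 <= r < n) 2 ^ r * odd (x %/ 2 ^ r) = x.
Proof.
elim: n x => [|n IH] x lt_x; first by rewrite big_geq //; case: x lt_x.
rewrite big_nat_recl // expn0 mul1n divn1.
under eq_bigr do rewrite expnS divnMA -mulnA.
by rewrite -big_distrr /= IH; [lia | rewrite expnS in lt_x; lia].
Qed.

Lemma exists_binary_digits (f : nat -> bool) n :
  exists2 a, a < 2 ^ n & forall i, i < n -> Nat.testbit a i = f i.
Proof.
elim: n f => [|n IH] f; first by exists 0.
have [a lt_a digits_a] := IH (fun i => f i.+1).
exists (f 0 + 2 * a) => [|i lt_i]; first by rewrite expnS; case: (f 0); lia.
have half_a : (f 0 + 2 * a) %/ 2 = a by case: (f 0); lia.
case: i lt_i => [|i] lt_i; rewrite testbitE.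
  by rewrite divn1 oddD oddM addbF; case: (f 0).
by rewrite expnS divnMA half_a -testbitE digits_a.
Qed.

(** * Sums over intervals *)

Lemma leq_sum_nat (F G : nat -> nat) a b :
  (forall i, a <= i < b -> F i <= G i) ->
  \sum_(a <= i < b) F i <= \sum_(a <= i < b) G i.
Proof.
move=> le_FG; rewrite big_nat_cond [leqRHS]big_nat_cond.
by apply: leq_sum => i /andP[/le_FG].
Qed.

Lemma leq_sum_interval (F : nat -> nat) a b a' b' : a' <= a -> b <= b' ->
  \sum_(a <= i < b) F i <= \sum_(a' <= i < b') F i.
Proof.
move=> le_a le_b; have [le_ba|lt_ab] := leqP b a; first by rewrite big_geq.
rewrite (@big_cat_nat _ _ _ a a' b') //=; last by lia.
by rewrite (@big_cat_nat _ _ _ b a b') //=; lia.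
Qed.

Lemma sum_nat_support (F : nat -> nat) n a b : a <= b -> b <= n ->
  (forall i, i < a -> F i = 0) -> (forall i, b <= i < n -> F i = 0) ->
  \sum_(0 <= i < n) F i = \sum_(a <= i < b) F i.
Proof.
move=> le_ab le_bn F_low F_high.
rewrite (@big_cat_nat _ _ _ a) //=; last by lia.
rewrite big_nat_cond big1 => [|i /andP[/andP[_ lt_i] _]]; last exact: F_low.
rewrite (@big_cat_nat _ _ _ b) //= [X in _ + (_ + X)]big_nat_cond.
by rewrite [X in _ + (_ + X)]big1 ?addn0 // => i /andP[/F_high].
Qed.

Lemma sum_nat_mirror (F : nat -> nat) n a b : a <= b <= n ->
  \sum_(a <= i < b) F (n - i.+1) = \sum_(n - b <= i < n - a) F i.
Proof.
case/andP=> /subnK <-; elim: (b - a) => [|d IH] le_bn.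
  by rewrite add0n !big_geq.
rewrite addSn big_nat_recr ?leq_addl //= IH; last by lia.
rewrite [RHS]big_ltn; last by lia.
by rewrite addnC; congr (_ + \sum_(_ <= i < _) F i); lia.
Qed.

Lemma sum_nat_double (F : nat -> nat) n :
  \sum_(0 <= v < 2 * n) F v = \sum_(0 <= p < n) (F (2 * p + false) + F (2 * p + true)).
Proof.
elim: n => [|n IH]; first by rewrite !big_geq.
have -> : 2 * n.+1 = (2 * n).+2 by lia.
by rewrite !big_nat_recr //= IH addn0 addn1 addnA.
Qed.

Lemma sum_nat_modn_eq q d x : x < d -> \sum_(0 <= i < q * d) (i %% d == x) = q.
Proof.
move=> lt_x; rewrite -[q in RHS]muln1 -[q in RHS]subn0 -sum_nat_const_nat big_nat_mul.
apply: eq_bigr => j _.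
have modnDr_mul i : (i + j * d) %% d = i %% d by rewrite addnC modnMDl.
rewrite mulSn -[j * d in X in \sum_(X <= _ < _) _]add0n big_addn addnK.
rewrite big_mkord (bigD1 (Ordinal lt_x)) //= modnDr_mul modn_small // eqxx big1 // => i.
by rewrite -val_eqE /= modnDr_mul modn_small // => /negbTE ->.
Qed.

(** * Words made of sorted blocks *)

Lemma flatten_iotaS (T : Type) (f : nat -> seq T) n :
  flatten [seq f i | i <- iota 0 n.+1] = flatten [seq f i | i <- iota 0 n] ++ f n.
Proof. by rewrite -addn1 iotaD map_cat flatten_cat /= cats0 add0n. Qed.

Lemma subseq_flatten_iota (T : eqType) (f : nat -> seq T) m n : m <= n ->
  subseq (flatten [seq f i | i <- iota 0 m]) (flatten [seq f i | i <- iota 0 n]).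
Proof.
move=> /subnK <-; elim: (n - m) => // d IH.
by rewrite addSn flatten_iotaS (subseq_trans IH) ?prefix_subseq.
Qed.

Lemma subseq_nseq (T : eqType) (x : T) m n : m <= n -> subseq (nseq m x) (nseq n x).
Proof. by move=> /subnK <-; rewrite addnC nseqD prefix_subseq. Qed.

Lemma subseq_catP (T : eqType) (C s t : seq T) : subseq C (s ++ t) ->
  exists C1 C2, [/\ C = C1 ++ C2, subseq C1 s & subseq C2 t].
Proof.
case/subseqP=> m size_m ->.
exists (mask (take (size s) m) s), (mask (drop (size s) m) t).
rewrite !mask_subseq; split=> //.
by rewrite -mask_cat ?cat_take_drop // size_takel // size_m size_cat leq_addr.
Qed.

Lemma subseq_flattenP (T : eqType) (ss : seq (seq T)) C : subseq C (flatten ss) ->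
  exists Ds, [/\ C = flatten Ds, size Ds = size ss &
    forall i, subseq (nth [::] Ds i) (nth [::] ss i)].
Proof.
elim: ss C => [|s ss IH] C /=.
  by case: C => // _; exists [::]; split=> // i; rewrite nth_nil.
case/subseq_catP=> C1 [C2 [-> sub1 /IH[Ds [-> size_Ds sub2]]]].
by exists (C1 :: Ds); split=> //= [|[|i]] //=; rewrite size_Ds.
Qed.

Lemma size_count_mem_sum (C : seq nat) V : (forall x, x \in C -> x < V) ->
  size C = \sum_(0 <= v < V) count_mem v C.
Proof.
elim: C => [|x C IH] lt_C /=; first by rewrite big1_eq.
rewrite big_split /= -IH => [|y Cy]; last by rewrite lt_C ?inE ?Cy ?orbT.
rewrite big_mkord (bigD1 (Ordinal (lt_C x (mem_head x C)))) //= eqxx big1 => [|i].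
  by rewrite addn0 add1n.
by rewrite -val_eqE /= eq_sym => /negbTE ->.
Qed.

Definition block (V : nat) (mu : nat -> nat) : seq nat :=
  flatten [seq nseq (mu v) v | v <- iota 0 V].

Definition block_word (H V : nat) (mu : nat -> nat -> nat) : seq nat :=
  flatten [seq block V (mu i) | i <- iota 0 H].

Lemma blockS V mu : block V.+1 mu = block V mu ++ nseq (mu V) V.
Proof. exact: flatten_iotaS. Qed.

Lemma block_wordS H V mu : block_word H.+1 V mu = block_word H V mu ++ block V (mu H).
Proof. exact: flatten_iotaS. Qed.

Lemma size_block V mu : size (block V mu) = \sum_(0 <= v < V) mu v.
Proof.
elim: V => [|V IH]; first by rewrite big_geq.
by rewrite blockS size_cat IH size_nseq big_nat_recr.
Qed.

Lemma size_block_word H V mu :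
  size (block_word H V mu) = \sum_(0 <= i < H) \sum_(0 <= v < V) mu i v.
Proof.
elim: H => [|H IH]; first by rewrite big_geq.
by rewrite block_wordS size_cat IH size_block big_nat_recr.
Qed.

Lemma count_block V mu v : count_mem v (block V mu) = (v < V) * mu v.
Proof.
elim: V => [|V IH] //; rewrite blockS count_cat IH count_nseq /= ltnS leq_eqVlt.
by rewrite [V == v]eq_sym; case: (ltngtP v V) => [lt|gt|->] /=; lia.
Qed.

Lemma mem_block V mu v : v \in block V mu -> v < V.
Proof.
by move=> /flattenP[s /mapP[u]]; rewrite mem_iota => /andP[_ lt_u] -> /nseqP[->].
Qed.

Lemma mem_block_word H V mu v : v \in block_word H V mu -> v < V.
Proof. by move=> /flattenP[s /mapP[u _ ->]] /mem_block. Qed.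

Lemma sorted_block V mu : sorted leq (block V mu).
Proof.
elim: V => [|V IH] //; rewrite blockS (sorted_pairwise leq_trans) pairwise_cat.
rewrite -!(sorted_pairwise leq_trans) IH /=; apply/andP; split.
  by apply/allrelP => x y /mem_block lt_x /nseqP[-> _]; apply: ltnW.
by elim: (mu V) => // -[|n] //= ->; rewrite leqnn.
Qed.

(* The run of [v] is taken from block [pos v]. *)
Lemma subseq_block_word H V mu c pos :
  (forall u v, u <= v -> v < V -> pos u <= pos v) ->
  (forall v, v < V -> pos v < H) ->
  (forall v, v < V -> c v <= mu (pos v) v) ->
  subseq (block V c) (block_word H V mu).
Proof.
move=> pos_mono pos_lt c_le.
suff prefix_fits v : v <= V -> forall P, (forall u, u < v -> pos u <= P) ->
    subseq (block v c) (block_word P V mu ++ block v (mu P)).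
  have [->|V_gt0] := posnP V; first by rewrite sub0seq.
  have lt_H := pos_lt V.-1 ltac:(lia).
  apply: (subseq_trans (prefix_fits V _ (pos V.-1) _)) => //.
    by move=> u lt_u; apply: pos_mono; lia.
  by rewrite -block_wordS; apply: subseq_flatten_iota.
elim: v => [|v IH] lt_v P le_P; first by rewrite sub0seq.
apply: (@subseq_trans _ (block_word (pos v) V mu ++ block v.+1 (mu (pos v)))).
  rewrite !blockS catA; apply: cat_subseq; last exact/subseq_nseq/c_le.
  by apply: IH => [|u lt_u]; [lia | apply: pos_mono; lia].
have [lt_vP|->] : pos v < P \/ pos v = P by have := le_P v (ltnSn v); lia.
  apply: (@subseq_trans _ (block_word (pos v).+1 V mu)).
    by rewrite block_wordS cat_subseq // subseq_flatten_iota.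
  by rewrite (subseq_trans (subseq_flatten_iota _ lt_vP)) ?prefix_subseq.
exact: subseq_refl.
Qed.

Section CutPoints.
Variable Ds : seq (seq nat).

Definition cut v := minn (find (has (leq v)) Ds) (size Ds).-1.

Lemma leq_cut u v : u <= v -> cut u <= cut v.
Proof.
move=> le_uv; rewrite leq_min geq_minr andbT (leq_trans (geq_minl _ _)) //.
by apply: sub_find => D; apply: sub_has => x; apply: leq_trans.
Qed.

Lemma cut_lt v : 0 < size Ds -> cut v < size Ds.
Proof. by rewrite /cut; lia. Qed.

Lemma notin_before_cut v i : i < cut v -> v \notin nth [::] Ds i.
Proof.
rewrite leq_min => /andP[/(before_find [::]) no_ge _].
by apply: contraFN no_ge => v_in; apply/hasP; exists v.
Qed.

Lemma notin_after_cut v i : sorted leq (flatten Ds) -> cut v.+1 < i < size Ds ->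
  v \notin nth [::] Ds i.
Proof.
move=> sortDs /andP[lt_i lt_is]; set f := find (has (leq v.+1)) Ds.
have lt_f : f < i by move: lt_i; rewrite /cut -/f; lia.
have /hasP[x fx lt_vx] : has (leq v.+1) (nth [::] Ds f).
  by rewrite nth_find // has_find -/f; lia.
apply/negP=> v_in.
have : pairwise leq (flatten Ds) by rewrite -(sorted_pairwise leq_trans).
rewrite -(cat_take_drop i Ds) flatten_cat pairwise_cat => /andP[/allrelP le_xv _].
suff : x <= v by lia.
apply: le_xv; last by rewrite (drop_nth [::]) //= mem_cat v_in.
apply/flattenP; exists (nth [::] Ds f) => //.
by rewrite -(nth_take _ lt_f) mem_nth // size_takel // ltnW.
Qed.

Lemma count_flatten_cut v : sorted leq (flatten Ds) -> 0 < size Ds ->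
  count_mem v (flatten Ds) =
  \sum_(cut v <= i < (cut v.+1).+1) count_mem v (nth [::] Ds i).
Proof.
move=> sortDs Ds_gt0.
rewrite count_flatten sumnE big_map (big_nth [::]); apply: sum_nat_support.
- by rewrite leqW // leq_cut.
- exact: cut_lt.
- by move=> i /notin_before_cut/count_memPn.
- by move=> i /(notin_after_cut sortDs)/count_memPn.
Qed.

End CutPoints.

Lemma block_word_cut_points H V mu C : 0 < H -> sorted leq C ->
  subseq C (block_word H V mu) ->
  exists e : nat -> nat, [/\ {homo e : u v / u <= v}, forall v, e v < H &
    forall v, v < V -> count_mem v C <= \sum_(e v <= i < (e v.+1).+1) mu i v].
Proof.
move=> H_gt0 sortC /subseq_flattenP[Ds [def_C]].
rewrite size_map size_iota => size_Ds subDs.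
have cut_ltH v : cut Ds v < H by rewrite -size_Ds cut_lt ?size_Ds.
exists (cut Ds); split=> // [u v|v lt_v]; first exact: leq_cut.
rewrite def_C count_flatten_cut -?def_C ?size_Ds //.
apply: leq_sum_nat => i /andP[_ lt_i].
have := subDs i; rewrite (nth_map 0) ?size_iota; last by have := cut_ltH v.+1; lia.
rewrite nth_iota ?add0n; last by have := cut_ltH v.+1; lia.
by move/(leq_count_subseq (pred1 v)); rewrite count_block lt_v mul1n.
Qed.

(** * Separators *)

Definition floor2 (r x : nat) : nat := x %/ 2 ^ r * 2 ^ r.

Lemma floor2_le r x : floor2 r x <= x. Proof. exact: leq_divM. Qed.

Lemma floor2_anti r r' x : r <= r' -> floor2 r' x <= floor2 r x.
Proof.
move=> /subnK <-; rewrite /floor2 expnD mulnA leq_mul2r; apply/orP; right.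
by rewrite [X in x %/ X]mulnC divnMA leq_divM.
Qed.

Definition sparse_run (r i : nat) : nat := (i %% 2 ^ r.+1 == 2 ^ r) * 2 ^ r.
Definition dense_run (r i : nat) : nat := (i %% 2 ^ r == 0) * 2 ^ r.

Lemma sparse_run_floor2 r x : sparse_run r (floor2 r x) = 2 ^ r * odd (x %/ 2 ^ r).
Proof.
rewrite /sparse_run /floor2 expnS -muln_modl modn2 mulnC; congr (_ * _).
by case: odd; rewrite ?mul1n ?eqxx // mul0n eq_sym -leqn0 leqNgt expn_gt0.
Qed.

Lemma dense_run_floor2 r x : dense_run r (floor2 r x) = 2 ^ r.
Proof. by rewrite /dense_run modnMl mul1n. Qed.

Lemma sum_sparse_run r k : r < k -> 2 * \sum_(0 <= i < 2 ^ k) sparse_run r i = 2 ^ k.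
Proof.
move=> lt_rk; have lt_d : 2 ^ r < 2 ^ r.+1 by rewrite ltn_exp2l.
rewrite -big_distrl /= mulnC -mulnA [2 ^ r * 2]mulnC -expnS.
by rewrite -{1}(subnK lt_rk) expnD sum_nat_modn_eq // -expnD subnK.
Qed.

Lemma sum_dense_run r k : r <= k -> \sum_(0 <= i < 2 ^ k) dense_run r i = 2 ^ k.
Proof.
move=> le_rk; rewrite -big_distrl /= -{1}(subnK le_rk) expnD sum_nat_modn_eq ?expn_gt0 //.
by rewrite -expnD subnK.
Qed.

Lemma floor2_split r x : floor2 r x = floor2 r.+1 x + 2 ^ r * odd (x %/ 2 ^ r).
Proof.
rewrite /floor2 expnS [x %/ (2 * _)]divnMA [x %/ 2 %/ _]divnAC.
by rewrite {1}(divn_eq (x %/ 2 ^ r) 2) modn2; lia.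
Qed.

Lemma sparse_run_first r x : sparse_run r x + floor2 r.+1 x <= floor2 r x.
Proof.
rewrite [leqRHS]floor2_split addnC leq_add2l /sparse_run mulnC leq_mul2l.
apply/orP; right; case: eqP => // x_eq.
by rewrite -modn2 modn_divl -expnS x_eq divnn expn_gt0.
Qed.

Lemma sparse_run_next r x : floor2 r x + sparse_run r x.+1 <= floor2 r x.+1.
Proof.
rewrite /sparse_run /floor2; set d := 2 ^ r; have d_gt0 : 0 < d by rewrite expn_gt0.
case: eqP => [x_eq|_]; last by rewrite mul0n addn0 leq_mul2r leq_div2r ?orbT.
have : d %| x.+1.
  by rewrite (divn_eq x.+1 (2 ^ r.+1)) x_eq dvdn_add // expnS !dvdn_mull.
case/dvdnP=> q def_x; rewrite def_x mulnK // mul1n -mulSnr leq_mul2r.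
by rewrite ltn_divLR // -def_x ltnSn orbT.
Qed.

Lemma sum_sparse_run_le r a b : a <= b ->
  \sum_(a <= i < b.+1) sparse_run r i + floor2 r.+1 a <= floor2 r b.
Proof.
move=> /subnK <-; elim: (b - a) => [|n IH].
  by rewrite add0n big_nat1 sparse_run_first.
rewrite addSn big_nat_recr ?leqW ?leq_addl //=.
by have := sparse_run_next r (n + a); lia.
Qed.

(* Each run of weight [2 ^ r] is charged to the [2 ^ r] positions ending at its own,
   and these intervals are disjoint. *)
Lemma sum_sparse_chain_le k (a b : nat -> nat) x :
  (forall l, l < k -> a l <= b l) ->
  (forall u l, u < l -> l < k -> b u <= a l) ->
  (forall l, l < k -> b l <= x) ->
  \sum_(0 <= l < k) \sum_(a l <= i < (b l).+1) sparse_run (k - l.+1) i <= x.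
Proof.
move=> le_ab le_ba le_bx.
suff chain n : n <= k -> forall y, (forall l, l < n -> b l <= y) ->
    \sum_(0 <= l < n) \sum_(a l <= i < (b l).+1) sparse_run (k - l.+1) i
      <= floor2 (k - n) y.
  exact: leq_trans (chain k (leqnn k) x le_bx) (floor2_le _ _).
elim: n => [|n IH] lt_n y le_by; first by rewrite big_geq.
rewrite big_nat_recr //=.
have prefix := IH (ltnW lt_n) (a n) (fun l lt_l => le_ba l n lt_l lt_n).
have last_run := sum_sparse_run_le (k - n.+1) (le_ab n lt_n).
have mono : floor2 (k - n.+1) (b n) <= floor2 (k - n.+1) y.
  by rewrite leq_mul2r leq_div2r ?orbT ?le_by.
by rewrite -subSn // subSS in last_run; lia.
Qed.

(** * The LCWIS instance *)

Section PairWords.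
Variables W k M : nat.

Definition separator_runs (l i : nat) (b : bool) : nat :=
  W * (if b then dense_run (k - l.+1) i else sparse_run (k - l.+1) i).

(* The pair of runs of a clause is (1, 2) or (3, 0) on one side, (2, 1) or (0, 3) on
   the other; the componentwise minimum has sum 2, unless it is that of (3, 0) and
   (0, 3). *)
Definition clause_runs (sat b : bool) : nat := if b then 2 * sat else 3 - 2 * sat.

(* The symbols [2 * p] and [2 * p + 1] form pair [p]: first [k] pairs of separators,
   then one pair for each clause, then the mirror image of the first separators. *)
Definition runs (t : nat -> nat -> bool) (i p : nat) (b : bool) : nat :=
  if p < k then separator_runs p i b
  else if p < k + M then clause_runs (t i (p - k)) b
  else separator_runs (2 * k + M - p.+1) (2 ^ k - i.+1) b.

(* The two symbols of a pair exchange their roles between sides 0 and 1. *)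
Definition side_runs (t : nat -> nat -> bool) (s i v : nat) : nat :=
  runs t i (v %/ 2) (odd (v + s)).

Definition alphabet_size : nat := 2 * (2 * k + M).

Definition side_word (t : nat -> nat -> bool) (s : nat) : seq nat :=
  block_word (2 ^ k) alphabet_size (side_runs t s).

Lemma runs_low t i p b : p < k -> runs t i p b = separator_runs p i b.
Proof. by rewrite /runs => ->. Qed.

Lemma runs_middle t i c b : c < M -> runs t i (k + c) b = clause_runs (t i c) b.
Proof. by move=> lt_c; rewrite /runs !ltnNge leq_addr leq_add2l -ltnNge lt_c addKn. Qed.

Lemma runs_high t i l b : l < k ->
  runs t i (2 * k + M - l.+1) b = separator_runs l (2 ^ k - i.+1) b.
Proof.
move=> lt_l; have mirror : 2 * k + M - (2 * k + M - l.+1).+1 = l by lia.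
by rewrite /runs mirror !ltnNge (_ : k <= _) 1?(_ : k + M <= _) //; lia.
Qed.

Lemma clause_runs_min x y :
  minn (clause_runs x false) (clause_runs y true)
    + minn (clause_runs x true) (clause_runs y false) = 2 * (x || y).
Proof. by case: x y => [] []. Qed.

Lemma side_runsE t s i p (b : bool) :
  side_runs t s i (2 * p + b) = runs t i p (b (+) odd s).
Proof.
rewrite /side_runs (_ : _ %/ 2 = p); last by case: b; lia.
by rewrite -addnA oddD oddM /= oddD oddb.
Qed.

Lemma side_runs_pair t s i p :
  side_runs t s i (2 * p + false) + side_runs t s i (2 * p + true) =
  runs t i p false + runs t i p true.
Proof. by rewrite !side_runsE; case: (odd s); rewrite // addnC. Qed.

Lemma sum_pairs (G : nat -> nat) : \sum_(0 <= p < 2 * k + M) G p =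
  \sum_(0 <= p < k) G p + \sum_(0 <= c < M) G (k + c)
    + \sum_(0 <= l < k) G (2 * k + M - l.+1).
Proof.
rewrite (@big_cat_nat _ _ _ k) //=; last by lia.
rewrite (@big_cat_nat _ _ _ (k + M) k) //=; [|lia|lia].
rewrite addnA sum_nat_mirror; last by lia.
congr (_ + _ + \sum_(_ <= _ < _) _); [|by lia|by lia].
rewrite -[X in \sum_(X <= _ < _) _]add0n big_addn addKn.
by apply: eq_bigr => c _; rewrite addnC.
Qed.

Lemma sum_separator_runs l : l < k ->
  2 * \sum_(0 <= i < 2 ^ k) (separator_runs l i false + separator_runs l i true)
  = 3 * W * 2 ^ k.
Proof.
move=> lt_l; rewrite big_split /= -!big_distrr /= sum_dense_run; last by lia.
by have := @sum_sparse_run (k - l.+1) k ltac:(lia); lia.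
Qed.

Lemma size_side_word t s : size (side_word t s) = 3 * (k * W + M) * 2 ^ k.
Proof.
set pair := fun p => \sum_(0 <= i < 2 ^ k) (runs t i p false + runs t i p true).
have low p : p < k -> 2 * pair p = 3 * W * 2 ^ k.
  move=> lt_p; rewrite -(sum_separator_runs lt_p); congr (2 * _).
  by apply: eq_bigr => i _; rewrite !runs_low.
have mid c : c < M -> pair (k + c) = 3 * 2 ^ k.
  move=> lt_c; rewrite mulnC -[2 ^ k in RHS]subn0 -sum_nat_const_nat.
  by apply: eq_bigr => i _; rewrite !runs_middle //; case: (t _ _).
have high l : l < k -> 2 * pair (2 * k + M - l.+1) = 3 * W * 2 ^ k.
  move=> lt_l; rewrite -(sum_separator_runs lt_l) [in RHS]big_nat_rev; congr (2 * _).
  by apply: eq_bigr => i _; rewrite !runs_high.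
transitivity (\sum_(0 <= p < 2 * k + M) pair p).
  rewrite size_block_word [RHS]exchange_big_nat; apply: eq_bigr => i _.
  by rewrite sum_nat_double; apply: eq_bigr => p _; rewrite side_runs_pair.
have sum_const n c (G : nat -> nat) : (forall p, p < n -> G p = c) ->
    \sum_(0 <= p < n) G p = n * c.
  move=> G_c; rewrite -[n in RHS]subn0 -sum_nat_const_nat.
  by apply: eq_big_nat => p; apply: G_c.
have low_sum := sum_const _ _ _ low; have high_sum := sum_const _ _ _ high.
rewrite -!big_distrr /= in low_sum high_sum.
by rewrite sum_pairs (sum_const _ _ _ mid); lia.
Qed.

Section Cuts.
Variables (t : nat -> nat -> bool) (s : nat) (C : seq nat) (e : nat -> nat).
Hypotheses (e_mono : {homo e : u v / u <= v}) (e_lt : forall v, e v < 2 ^ k).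
Hypothesis count_le : forall v, v < alphabet_size ->
  count_mem v C <= \sum_(e v <= i < (e v.+1).+1) side_runs t s i v.

Lemma count_pair_le p (b : bool) : p < 2 * k + M -> count_mem (2 * p + b) C <=
  \sum_(e (2 * p + b) <= i < (e (2 * p + b).+1).+1) runs t i p (b (+) odd s).
Proof.
move=> lt_p; apply: leq_trans (count_le _) _; first by rewrite /alphabet_size; case: b; lia.
by apply: leq_sum_nat => i _; rewrite side_runsE.
Qed.

Lemma count_low_le : \sum_(0 <= p < k) count_mem (2 * p + odd s) C <= W * e (2 * k).
Proof.
apply: (@leq_trans (W * \sum_(0 <= p < k)
    \sum_(e (2 * p + odd s) <= i < (e (2 * p + odd s).+1).+1) sparse_run (k - p.+1) i)).
  rewrite big_distrr; apply: leq_sum_nat => p lt_p; rewrite big_distrr.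
  apply: leq_trans (count_pair_le _ _) _; first by lia.
  by apply: leq_sum_nat => i _; rewrite addbb runs_low.
rewrite leq_mul2l; apply/orP; right; apply: sum_sparse_chain_le.
- by move=> p _; apply: e_mono.
- by move=> u p lt_u _; apply: e_mono; case: (odd s); lia.
- by move=> p lt_p; apply: e_mono; case: (odd s); lia.
Qed.

Lemma count_high_le :
  \sum_(0 <= l < k) count_mem (2 * (2 * k + M - l.+1) + odd s) C
    <= W * (2 ^ k - (e (2 * (k + M))).+1).
Proof.
pose v l := 2 * (2 * k + M - l.+1) + odd s.
apply: (@leq_trans (W * \sum_(0 <= l < k)
    \sum_(2 ^ k - (e (v l).+1).+1 <= i < (2 ^ k - (e (v l)).+1).+1)
      sparse_run (k - l.+1) i)).
  rewrite big_distrr; apply: leq_sum_nat => l lt_l; rewrite big_distrr.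
  apply: leq_trans (count_pair_le _ _) _; first by lia.
  rewrite -subSn ?e_lt // subSS -sum_nat_mirror; last by rewrite leqW ?e_mono ?e_lt.
  by apply: leq_sum_nat => i _; rewrite addbb runs_high.
rewrite leq_mul2l; apply/orP; right; apply: sum_sparse_chain_le.
- by move=> l _; rewrite leq_sub2l // ltnS e_mono.
- by move=> u l lt_u lt_l; rewrite leq_sub2l // ltnS e_mono // /v; case: (odd s); lia.
- by move=> l lt_l; rewrite leq_sub2l // ltnS e_mono // /v; case: (odd s); lia.
Qed.

Lemma count_middle_le :
  \sum_(0 <= c < M) (count_mem (2 * (k + c) + false) C + count_mem (2 * (k + c) + true) C)
    <= 3 * M * (e (2 * (k + M)) - e (2 * k)).+1.
Proof.
have count_clause c (b : bool) : c < M -> count_mem (2 * (k + c) + b) C <=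
    \sum_(e (2 * k) <= i < (e (2 * (k + M))).+1) clause_runs (t i c) (b (+) odd s).
  move=> lt_c; apply: leq_trans (count_pair_le _ _) _; first by lia.
  apply: (@leq_trans (\sum_(e (2 * k) <= i < (e (2 * (k + M))).+1)
      runs t i (k + c) (b (+) odd s))).
    by apply: leq_sum_interval; rewrite ?ltnS e_mono //; case: b; lia.
  by apply: leq_sum_nat => i _; rewrite runs_middle.
apply: (@leq_trans (\sum_(0 <= c < M) 3 * (e (2 * (k + M)) - e (2 * k)).+1)); last first.
  by rewrite sum_nat_const_nat subn0 mulnCA mulnA.
apply: leq_sum_nat => c lt_c.
apply: leq_trans (leq_add (count_clause c _ _) (count_clause c _ _)) _ => //.
rewrite -big_split -subSn; last by apply: e_mono; lia.
rewrite [leqRHS]mulnC -sum_nat_const_nat; apply: leq_sum_nat => i _ /=.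
by case: (t i c); case: (odd s).
Qed.

Lemma count_middle_single c (b : bool) : e (2 * k) = e (2 * (k + M)) -> c < M ->
  count_mem (2 * (k + c) + b) C <= clause_runs (t (e (2 * k)) c) (b (+) odd s).
Proof.
move=> eq_e lt_c; apply: leq_trans (count_pair_le _ _) _; first by lia.
have le1 : e (2 * k) <= e (2 * (k + c) + b) by apply: e_mono; lia.
have le2 : e (2 * (k + c) + b).+1 <= e (2 * (k + M)).
  by apply: e_mono; have := leq_b1 b; lia.
have le3 : e (2 * (k + c) + b) <= e (2 * (k + c) + b).+1 by apply: e_mono.
have -> : e (2 * (k + c) + b) = e (2 * k) by lia.
have -> : e (2 * (k + c) + b).+1 = e (2 * k) by lia.
by rewrite big_nat1 runs_middle.
Qed.

End Cuts.

Definition pair_score (tA tB : nat -> nat -> bool) (i j : nat) : nat :=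
  \sum_(0 <= c < M) (tA i c || tB j c).

Lemma side_counts t s C : sorted leq C -> subseq C (side_word t s) ->
  exists x y, [/\ x <= y < 2 ^ k,
    \sum_(0 <= p < k) count_mem (2 * p + odd s) C <= W * x,
    \sum_(0 <= l < k) count_mem (2 * (2 * k + M - l.+1) + odd s) C <= W * (2 ^ k - y.+1),
    \sum_(0 <= c < M) (count_mem (2 * (k + c) + false) C + count_mem (2 * (k + c) + true) C)
      <= 3 * M * (y - x).+1 &
    x = y -> forall c (b : bool), c < M ->
      count_mem (2 * (k + c) + b) C <= clause_runs (t x c) (b (+) odd s)].
Proof.
move=> sortC subC.
have [e [e_mono e_lt count_le]] :=
  block_word_cut_points (expn_gt0 2 k : 0 < 2 ^ k) sortC subC.
exists (e (2 * k)), (e (2 * (k + M))); split.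
- by rewrite e_mono ?e_lt //; lia.
- exact: count_low_le count_le.
- exact: count_high_le count_le.
- exact: count_middle_le count_le.
- by move=> eq_e c b; apply: (count_middle_single e_mono count_le b eq_e).
Qed.

Lemma size_pairs (C : seq nat) : (forall v, v \in C -> v < alphabet_size) ->
  let cnt v := count_mem v C in
  size C = (\sum_(0 <= p < k) cnt (2 * p + false) + \sum_(0 <= p < k) cnt (2 * p + true))
    + \sum_(0 <= c < M) (cnt (2 * (k + c) + false) + cnt (2 * (k + c) + true))
    + (\sum_(0 <= l < k) cnt (2 * (2 * k + M - l.+1) + false)
        + \sum_(0 <= l < k) cnt (2 * (2 * k + M - l.+1) + true)).
Proof.
by move=> lt_C cnt; rewrite (size_count_mem_sum lt_C) sum_nat_double sum_pairs !big_split.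
Qed.

(* When the middle symbols come from several blocks of a side, the separators lose at
   least [W], more than the middle symbols can gain. *)
Lemma common_wis_size_le tA tB C : 6 * M <= W -> sorted leq C ->
  subseq C (side_word tA 0) -> subseq C (side_word tB 1) ->
  exists i j, [/\ i < 2 ^ k, j < 2 ^ k &
    size C <= 2 * W * (2 ^ k - 1) + 2 * pair_score tA tB i j].
Proof.
move=> W_large sortC subA subB.
have [x1 [x2 [lt_x lowA highA midA singleA]]] := side_counts sortC subA.
have [y1 [y2 [lt_y lowB highB midB singleB]]] := side_counts sortC subB.
have lt_C v : v \in C -> v < alphabet_size by move/(mem_subseq subA)/mem_block_word.
exists x1, y1; split; [by lia | by lia |].
rewrite (size_pairs lt_C) /= in lowA highA midA lowB highB midB *.
set mid := (X in _ + X + _) in midA midB *.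
have mid_le : mid <= W * (x2 - x1) + W * (y2 - y1) + 2 * pair_score tA tB x1 y1.
  have split_gap d : 0 < d -> 3 * M * d.+1 <= W * d.
    move=> d_gt0; apply: (@leq_trans (6 * M * d)); first by nia.
    by rewrite leq_mul2r W_large orbT.
  have [eq_x|ne_x] := eqVneq x1 x2; last first.
    apply: leq_trans midA (leq_trans (split_gap _ _) _); first by lia.
    by rewrite -addnA leq_addr.
  have [eq_y|ne_y] := eqVneq y1 y2; last first.
    apply: leq_trans midB (leq_trans (split_gap _ _) _); first by lia.
    by rewrite addnAC leq_addl.
  apply: leq_trans (leq_addl _ _); rewrite big_distrr; apply: leq_sum_nat => c lt_c.
  rewrite /= -clause_runs_min leq_add // leq_min; apply/andP; split.
  - exact: (singleA eq_x c false).
  - exact: (singleB eq_y c false).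
  - exact: (singleA eq_x c true).
  - exact: (singleB eq_y c true).
have total z1 z2 low high : z1 <= z2 < 2 ^ k -> low <= W * z1 ->
    high <= W * (2 ^ k - z2.+1) -> low + W * (z2 - z1) + high <= W * (2 ^ k - 1).
  move=> lt_z le_low le_high.
  apply: leq_trans (leq_add (leq_add le_low (leqnn _)) le_high) _.
  by rewrite -!mulnDr leq_mul2l; apply/orP; right; lia.
move: (total _ _ _ _ lt_x lowA highA) (total _ _ _ _ lt_y lowB highB) mid_le.
rewrite -[2 * W * _]mulnA; move: (W * (2 ^ k - 1)) (W * (x2 - x1)) (W * (y2 - y1)); lia.
Qed.

(* The block that a common subsequence meant for block [i] uses for pair [p]. *)
Definition source_block (i p : nat) : nat :=
  if p < k then floor2 (k - p.+1) i
  else if p < k + M then i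
  else 2 ^ k - (floor2 (p - (k + M)) (2 ^ k - i.+1)).+1.

Lemma source_block_lt i p : i < 2 ^ k -> source_block i p < 2 ^ k.
Proof.
move=> lt_i; rewrite /source_block; case: ifP => _; last by case: ifP => _ //; lia.
exact: leq_ltn_trans (floor2_le _ _) lt_i.
Qed.

Lemma source_block_mono i p q : i < 2 ^ k -> p <= q -> source_block i p <= source_block i q.
Proof.
move=> lt_i le_pq; rewrite /source_block.
have le_low r : floor2 r i <= i := floor2_le r i.
have le_high r : floor2 r (2 ^ k - i.+1) <= 2 ^ k - i.+1 := floor2_le r _.
have [lt_qk|le_kq] := ltnP q k.
  by rewrite (leq_ltn_trans le_pq lt_qk) floor2_anti //; lia.
have [lt_qM|le_Mq] := ltnP q (k + M).
  by rewrite (leq_ltn_trans le_pq lt_qM); case: ifP.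
have := le_high (q - (k + M)); have := le_low (k - p.+1).
case: ifP => _; first by lia.
case: ifP => _; first by lia.
by move=> _ _; rewrite leq_sub2l // ltnS floor2_anti //; lia.
Qed.

Definition best_run (tA tB : nat -> nat -> bool) (i j v : nat) : nat :=
  minn (side_runs tA 0 (source_block i (v %/ 2)) v)
       (side_runs tB 1 (source_block j (v %/ 2)) v).

Lemma best_run_pair tA tB i j p :
  let iA := source_block i p in let jB := source_block j p in
  best_run tA tB i j (2 * p + false) + best_run tA tB i j (2 * p + true) =
  minn (runs tA iA p false) (runs tB jB p true)
    + minn (runs tA iA p true) (runs tB jB p false).
Proof.
move=> iA jB; rewrite /best_run !side_runsE /=.
by rewrite (_ : (2 * p + 0) %/ 2 = p) 1?(_ : (2 * p + 1) %/ 2 = p) //; lia.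
Qed.

Lemma separator_runs_min l x y :
  let r := k - l.+1 in
  minn (separator_runs l (floor2 r x) false) (separator_runs l (floor2 r y) true)
    + minn (separator_runs l (floor2 r x) true) (separator_runs l (floor2 r y) false)
  = W * (2 ^ r * odd (x %/ 2 ^ r)) + W * (2 ^ r * odd (y %/ 2 ^ r)).
Proof.
move=> r; rewrite /separator_runs -/r !dense_run_floor2 !sparse_run_floor2.
have digit_le z : W * (2 ^ r * odd (z %/ 2 ^ r)) <= W * 2 ^ r.
  by case: odd; rewrite ?muln0 ?muln1.
by rewrite (minn_idPl (digit_le x)) (minn_idPr (digit_le y)).
Qed.

Lemma sum_separator_digits x : x < 2 ^ k ->
  \sum_(0 <= l < k) W * (2 ^ (k - l.+1) * odd (x %/ 2 ^ (k - l.+1))) = W * x.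
Proof.
move=> lt_x; rewrite -[in RHS](sum_binary_digits lt_x) big_distrr /=.
by rewrite [RHS]big_nat_rev.
Qed.

Lemma sum_best_run tA tB i j : i < 2 ^ k -> j < 2 ^ k ->
  \sum_(0 <= v < alphabet_size) best_run tA tB i j v =
  2 * W * (2 ^ k - 1) + 2 * pair_score tA tB i j.
Proof.
move=> lt_i lt_j; rewrite sum_nat_double sum_pairs.
have low : \sum_(0 <= p < k) (best_run tA tB i j (2 * p + false)
    + best_run tA tB i j (2 * p + true)) = W * i + W * j.
  rewrite -(sum_separator_digits lt_i) -(sum_separator_digits lt_j) -big_split.
  apply: eq_big_nat => p /andP[_ lt_p].
  by rewrite best_run_pair /source_block lt_p !runs_low // separator_runs_min.
have middle : \sum_(0 <= c < M) (best_run tA tB i j (2 * (k + c) + false)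
    + best_run tA tB i j (2 * (k + c) + true)) = 2 * pair_score tA tB i j.
  rewrite big_distrr; apply: eq_big_nat => c /andP[_ lt_c].
  rewrite best_run_pair !runs_middle // clause_runs_min.
  by rewrite /source_block ltnNge leq_addr ltn_add2l lt_c.
have high : \sum_(0 <= l < k) (best_run tA tB i j (2 * (2 * k + M - l.+1) + false)
    + best_run tA tB i j (2 * (2 * k + M - l.+1) + true))
    = W * (2 ^ k - i.+1) + W * (2 ^ k - j.+1).
  rewrite -(@sum_separator_digits (2 ^ k - i.+1)) ?ltn_subrL ?expn_gt0 //.
  rewrite -(@sum_separator_digits (2 ^ k - j.+1)) ?ltn_subrL ?expn_gt0 // -big_split /=.
  apply: eq_big_nat => l /andP[_ lt_l]; rewrite best_run_pair !runs_high //.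
  rewrite -separator_runs_min.
  have sourceE x : 2 ^ k - (source_block x (2 * k + M - l.+1)).+1 =
      floor2 (k - l.+1) (2 ^ k - x.+1).
    have := floor2_le (k - l.+1) (2 ^ k - x.+1).
    rewrite /source_block !ifF; [|lia|lia].
    by rewrite (_ : 2 * k + M - l.+1 - (k + M) = k - l.+1); lia.
  by rewrite !sourceE.
rewrite low middle high.
have weight z : z < 2 ^ k -> W * (2 ^ k - 1) = W * z + W * (2 ^ k - z.+1).
  by move=> lt_z; rewrite -mulnDr; congr (_ * _); lia.
by have := weight _ lt_i; have := weight _ lt_j; lia.
Qed.

Lemma common_wis_exists tA tB i j : i < 2 ^ k -> j < 2 ^ k ->
  exists C, [/\ sorted leq C, subseq C (side_word tA 0), subseq C (side_word tB 1) &
    size C = 2 * W * (2 ^ k - 1) + 2 * pair_score tA tB i j].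
Proof.
move=> lt_i lt_j; exists (block alphabet_size (best_run tA tB i j)).
have mono x u v : x < 2 ^ k -> u <= v ->
    source_block x (u %/ 2) <= source_block x (v %/ 2).
  by move=> lt_x le_uv; rewrite source_block_mono ?leq_div2r.
split; last by rewrite size_block sum_best_run.
- exact: sorted_block.
- apply: (subseq_block_word (pos := fun v => source_block i (v %/ 2))) => *.
  + exact: mono.
  + exact: source_block_lt.
  + exact: geq_minl.
- apply: (subseq_block_word (pos := fun v => source_block j (v %/ 2))) => *.
  + exact: mono.
  + exact: source_block_lt.
  + exact: geq_minr.
Qed.

Lemma is_LCWIS_length_sides tA tB best : 6 * M <= W ->
  (exists i j, [/\ i < 2 ^ k, j < 2 ^ k & pair_score tA tB i j = best]) ->
  (forall i j, i < 2 ^ k -> j < 2 ^ k -> pair_score tA tB i j <= best) ->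
  is_LCWIS_length (side_word tA 0) (side_word tB 1) (2 * W * (2 ^ k - 1) + 2 * best).
Proof.
move=> W_large [i [j [lt_i lt_j score_best]]] best_max.
split=> [|C [sortC subA subB]].
  have [C [sortC subA subB size_C]] := common_wis_exists tA tB lt_i lt_j.
  by exists C; rewrite ?size_C ?score_best.
have [i' [j' [lt_i' lt_j' le_C]]] := common_wis_size_le W_large sortC subA subB.
by apply: leq_trans le_C _; rewrite leq_add2l leq_mul2l best_max.
Qed.

End PairWords.

(** * Half assignments *)

Definition half_vars (N : nat) : nat := (N + 1) %/ 2.

Definition log_rows (N M : nat) : nat := minn (half_vars N) M.

Lemma half_vars_le N : half_vars N <= N.
Proof. by rewrite /half_vars; lia. Qed.

Lemma log_rows_le_half N M : log_rows N M <= half_vars N.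
Proof. exact: geq_minl. Qed.

Lemma log_rows_le_clauses N M : log_rows N M <= M.
Proof. exact: geq_minr. Qed.

Section HalfAssignments.
Variables (N : nat) (F : cnf N).
Local Notation M := (size F).
Local Notation h := (half_vars N).

(* Side [s] owns the variables [i] with [s * h <= i < s * h + h]; digit [i - s * h] of
   [a] is the value of variable [i]. *)
Definition half_sat_clause (s a : nat) (c : clause N) : bool :=
  has (fun x : literal N => (s * h <= x.1 < s * h + h)
         && (Nat.testbit a (x.1 - s * h) == x.2)) c.

Definition half_sat (s a c : nat) : bool := half_sat_clause s a (nth [::] F c).

Definition join_halves (a b : nat) : {ffun 'I_N -> bool} :=
  [ffun i : 'I_N => if i < h then Nat.testbit a i else Nat.testbit b (i - h)].

Lemma join_halvesP (x : {ffun 'I_N -> bool}) :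
  exists a b, [/\ a < 2 ^ h, b < 2 ^ h & x = join_halves a b].
Proof.
pose value i := if insub i is Some k then x k else false.
have [a lt_a digits_a] := exists_binary_digits value h.
have [b lt_b digits_b] := exists_binary_digits (fun i => value (h + i)) h.
exists a, b; split=> //; apply/ffunP => i; rewrite ffunE.
have valueE : value i = x i by rewrite /value valK.
have [lt_ih|le_hi] := ltnP i h; first by rewrite digits_a.
rewrite digits_b ?subnKC ?valueE //.
by have := ltn_ord i; move: le_hi; rewrite /half_vars; lia.
Qed.

Lemma sat_join_halves a b c :
  sat_clause (join_halves a b) c = half_sat_clause 0 a c || half_sat_clause 1 b c.
Proof.
rewrite /sat_clause /half_sat_clause -has_predU; apply: eq_has => -[i v] /=.
rewrite mul0n add0n subn0 mul1n ffunE.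
have lt_i : i < h + h by have := ltn_ord i; rewrite /half_vars; lia.
by rewrite lt_i andbT; case: (ltnP i h); rewrite /= ?orbF.
Qed.

Lemma count_sat_join_halves a b :
  count (sat_clause (join_halves a b)) F = pair_score M (half_sat 0) (half_sat 1) a b.
Proof.
rewrite -sum1_count big_mkcond (big_nth [::]); apply: eq_bigr => c _.
by rewrite sat_join_halves /half_sat; case: (_ || _).
Qed.

Fixpoint row_code (s a n : nat) : nat :=
  if n is n'.+1 then 2 * row_code s a n' + half_sat s a n' else 0.

(* When there are fewer clauses than variables in a half, the half assignments are
   grouped by the set of clauses that they satisfy: this keeps the number of rows
   at most [2 ^ M]. *)
Definition partial_index (s a n : nat) : nat := if M < h then row_code s a n else a.

Definition row_index (s a : nat) : nat := partial_index s a M.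

Definition rows_upto (n s i c : nat) : bool :=
  has (fun a => (row_index s a == i) && half_sat s a c) (iota 0 n).

Definition row_table : nat -> nat -> nat -> bool := rows_upto (2 ^ h).

Lemma row_code_lt s a n : row_code s a n < 2 ^ n.
Proof. by elim: n => //= n IH; rewrite expnS; case: half_sat; lia. Qed.

Lemma row_code_inj s a b n : row_code s a n = row_code s b n ->
  forall c, c < n -> half_sat s a c = half_sat s b c.
Proof.
elim: n => // n IH /= eq_code c.
have eq_last : half_sat s a n = half_sat s b n by move: eq_code; do 2!case: half_sat; lia.
by rewrite ltnS leq_eqVlt => /orP[/eqP-> //|]; apply: IH; lia.
Qed.

Lemma row_index_lt s a : a < 2 ^ h -> row_index s a < 2 ^ log_rows N M.
Proof.
rewrite /row_index /partial_index /log_rows.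
by case: (ltnP M h) => // _ _; apply: row_code_lt.
Qed.

Lemma partial_index_le s a n : a < 2 ^ h -> n <= M -> partial_index s a n <= 2 ^ h.
Proof.
move=> lt_a le_n; rewrite /partial_index; case: ifP => [lt_M|_]; last exact: ltnW.
by apply/ltnW/(leq_trans (row_code_lt _ _ _)); rewrite leq_exp2l //; lia.
Qed.

Lemma row_index_inj s a b c : row_index s a = row_index s b -> c < M ->
  half_sat s a c = half_sat s b c.
Proof.
rewrite /row_index /partial_index.
by case: (ltnP M h) => _ => [/row_code_inj|->]; first exact.
Qed.

Lemma row_table_index s a c : a < 2 ^ h -> c < M ->
  row_table s (row_index s a) c = half_sat s a c.
Proof.
move=> lt_a lt_c; apply/hasP/idP => [[b _ /andP[/eqP/row_index_inj -> //]]|sat_a].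
by exists a; rewrite ?mem_iota ?eqxx.
Qed.

Lemma row_table_dominated s i :
  exists a, forall c, c < M -> row_table s i c -> half_sat s a c.
Proof.
have [/hasP[a a_in /eqP <-]|no_row] :=
  boolP (has (fun a => row_index s a == i) (iota 0 (2 ^ h))).
  by exists a => c lt_c; rewrite row_table_index //; move: a_in; rewrite mem_iota.
exists 0 => c _ /hasP[b b_in /andP[eq_b _]].
by case/hasP: no_row; exists b.
Qed.

Lemma row_score_le_max_sat i j : pair_score M (row_table 0) (row_table 1) i j <= max_sat F.
Proof.
have [a dom_a] := row_table_dominated 0 i; have [b dom_b] := row_table_dominated 1 j.
apply: leq_trans (leq_bigmax (join_halves a b)); rewrite count_sat_join_halves.
apply: leq_sum_nat => c lt_c; have := dom_a c lt_c; have := dom_b c lt_c.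
by do 2!case: row_table => [/(_ isT) ->|_]; rewrite ?orbT.
Qed.

Lemma row_score_max_sat : exists i j, [/\ i < 2 ^ log_rows N M, j < 2 ^ log_rows N M &
  pair_score M (row_table 0) (row_table 1) i j = max_sat F].
Proof.
have [x max_x] : {x : {ffun 'I_N -> bool} | max_sat F = count (sat_clause x) F}.
  by apply: bigop.eq_bigmax; apply/card_gt0P; exists [ffun=> true].
have [a [b [lt_a lt_b def_x]]] := join_halvesP x.
exists (row_index 0 a), (row_index 1 b); split; [exact: row_index_lt.. |].
rewrite max_x def_x count_sat_join_halves; apply: eq_big_nat => c lt_c.
by rewrite !row_table_index.
Qed.

Definition instance_side (s : nat) : seq nat :=
  side_word (6 * M) (log_rows N M) M (row_table s) s.

Lemma is_LCWIS_length_instance :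
  is_LCWIS_length (instance_side 0) (instance_side 1)
    (12 * M * (2 ^ log_rows N M - 1) + 2 * max_sat F).
Proof.
rewrite (_ : 12 * M = 2 * (6 * M)); last by lia.
apply: is_LCWIS_length_sides; first by [].
  exact: row_score_max_sat.
by move=> i j _ _; apply: row_score_le_max_sat.
Qed.

End HalfAssignments.

(** * Clauses as pairs of bit masks *)

Definition add_to_mask N (b : bool) (mask : nat) (x : literal N) : nat :=
  if x.2 == b then Nat.lor mask (Nat.shiftl 1 x.1) else mask.

Definition clause_mask N (b : bool) (c : clause N) : nat := foldl (@add_to_mask N b) 0 c.

Lemma testbit_clause_mask N (b : bool) (c : clause N) i : Nat.testbit (clause_mask b c) i =
  has (fun x : literal N => (x.2 == b) && (x.1 == i :> nat)) c.
Proof.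
rewrite /clause_mask -[RHS]orFb -(PeanoNat.Nat.bits_0 i).
elim: c (0) => [|x c IH] mask /=; first by rewrite orbF.
rewrite IH /add_to_mask orbA; congr (_ || _).
by case: (x.2 == b); rewrite /= ?orbF // PeanoNat.Nat.lor_spec testbit_shiftl1.
Qed.

Definition masked_sat (h s a pos neg : nat) : nat :=
  Nat.lor (Nat.land pos (Nat.shiftl a (s * h)))
    (Nat.land neg (Nat.shiftl (Nat.lxor a (2 ^ h - 1)) (s * h))).

Lemma testbit_masked_sat N s a (c : clause N) i : a < 2 ^ half_vars N ->
  Nat.testbit (masked_sat (half_vars N) s a (clause_mask true c) (clause_mask false c)) i =
  has (fun x : literal N => (x.1 == i :> nat)
    && ((s * half_vars N <= i < s * half_vars N + half_vars N)
        && (Nat.testbit a (i - s * half_vars N) == x.2))) c.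
Proof.
move=> /ltn_exp2_testbit high_a; set h := half_vars N in high_a *.
rewrite PeanoNat.Nat.lor_spec !PeanoNat.Nat.land_spec !testbit_clause_mask !testbit_shiftl.
rewrite PeanoNat.Nat.lxor_spec testbit_ones.
have [in_half|out_half] := boolP (s * h <= i < s * h + h).
  have -> : s * h <= i by lia.
  have -> : i - s * h < h by lia.
  case: (Nat.testbit a _); rewrite ?andbT ?andbF ?orbF ?orFb /=;
    by apply: eq_has => -[y []]; rewrite /= ?andbT ?andbF.
rewrite [RHS](eq_has (a2 := pred0)) ?has_pred0 => [|x]; last by rewrite /= andbF.
rewrite negb_and -ltnNge -leqNgt in out_half.
have [le_hi|_] := leqP (s * h) i; last by rewrite !andbF.
have le_h : h <= i - s * h by lia.
by rewrite high_a // (leq_gtF le_h) !andbF.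
Qed.

Lemma masked_sat_gt0 N s a (c : clause N) : a < 2 ^ half_vars N ->
  (0 < masked_sat (half_vars N) s a (clause_mask true c) (clause_mask false c))
  = half_sat_clause s a c.
Proof.
move=> lt_a; have digit := testbit_masked_sat s c ^~ lt_a.
apply/idP/hasP => [mask_gt0|[x cx sat_x]].
  have [i] : exists i, Nat.testbit (masked_sat (half_vars N) s a
      (clause_mask true c) (clause_mask false c)) i.
    by apply: testbit_inhabited; lia.
  by rewrite digit => /hasP[x cx /andP[/eqP <- sat_x]]; exists x.
have : Nat.testbit (masked_sat (half_vars N) s a
    (clause_mask true c) (clause_mask false c)) x.1.
  by rewrite digit; apply/hasP; exists x => //; rewrite eqxx.
by case: masked_sat => //; rewrite PeanoNat.Nat.bits_0.
Qed.

(** * A structured language for the word RAM *)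

Inductive expr (V : Type) : Type :=
  | Var of V
  | Cst of nat
  | Bin of binop & expr V & expr V
  | Fetch of expr V
  | Ite of expr V & expr V & expr V.

Arguments Cst {V}.
Arguments Bin {V} _ & _ _.
Arguments Ite {V} & _ _ _.

Inductive prog (V : Type) : Type :=
  | Assign of V & expr V
  | Store of expr V & expr V
  | Then of prog V & prog V
  | For of V & expr V & prog V.

Arguments Assign {V} & _ _.
Arguments Store {V} & _ _.
Arguments Then {V} & _ _.
Arguments For {V} & _ _ _.

Declare Scope expr_scope.
Delimit Scope expr_scope with expr.
Bind Scope expr_scope with expr.
Notation "a + b" := (Bin OpAdd a b) : expr_scope.
Notation "a - b" := (Bin OpSub a b) : expr_scope.
Notation "a * b" := (Bin OpMul a b) : expr_scope.
Notation "a %/ b" := (Bin OpDiv a b) : expr_scope.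
Notation "a %% b" := (Bin OpMod a b) : expr_scope.
Notation "a && b" := (Bin OpAnd a b) : expr_scope.
Notation "a || b" := (Bin OpOr a b) : expr_scope.
Notation "a 'shl' b" := (Bin OpShl a b) (at level 45, left associativity) : expr_scope.
Notation "a == b" := (Bin OpEq a b) : expr_scope.
Notation "a < b" := (Bin OpLt a b) : expr_scope.

Declare Scope prog_scope.
Delimit Scope prog_scope with prog.
Bind Scope prog_scope with prog.
Notation "x ::= e" := (Assign x e%expr) (at level 75) : prog_scope.
Notation "'mem[' a ] ::= e" := (Store a%expr e%expr)
  (at level 0, a at level 99, e at level 75) : prog_scope.
Notation "p ;; q" := (Then p q) (at level 80, right associativity) : prog_scope.
Notation "'for' x '<' e 'do' p" := (For x e%expr p)
  (at level 79, x at level 0, e at level 60, p at level 79) : prog_scope.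

Definition set_var (V : eqType) (rho : V -> nat) (x : V) (v : nat) : V -> nat :=
  fun y => if y == x then v else rho y.

Section Expressions.
Variable V : Type.
Implicit Types (e : expr V) (rho : V -> nat) (m : nat -> nat).

Fixpoint eval_expr e rho m : nat :=
  match e with
  | Var x => rho x
  | Cst v => v
  | Bin o a b => eval_binop o (eval_expr a rho m) (eval_expr b rho m)
  | Fetch a => m (eval_expr a rho m)
  | Ite c a b => if eval_expr c rho m == 0 then eval_expr b rho m else eval_expr a rho m
  end.

Fixpoint cost e : nat :=
  match e with
  | Var _ | Cst _ => 1
  | Bin _ a b => cost a + (cost b + 1)
  | Fetch a => cost a + 1
  | Ite c a b => cost c + (maxn (cost a) (cost b)).+1
  end.

(* Widths are in units of [l] bits: variables and memory cells have [cell_width] of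
   them, and a word at least [word_width]. *)
Definition cell_width : nat := 16.
Definition word_width : nat := 64.
Definition cell_bound (l : nat) : nat := 2 ^ (l * cell_width).

Definition binop_width (o : binop) (a b : nat) : nat :=
  match o with
  | OpAdd => (maxn a b).+1
  | OpMul => a + b
  | OpSub | OpDiv | OpMod | OpAnd | OpShr => a
  | OpOr | OpXor => maxn a b
  | OpShl => a + 2
  | OpEq | OpLt => 1
  end.

Fixpoint width e : nat :=
  match e with
  | Var _ | Fetch _ => cell_width
  | Cst v => v
  | Bin o a b => binop_width o (width a) (width b)
  | Ite _ a b => maxn (width a) (width b)
  end.

Fixpoint fits e : bool :=
  (width e <= word_width) &&
  match e with
  | Var _ | Cst _ => true
  | Bin _ a b => fits a && fits b
  | Fetch a => fits a
  | Ite c a b => [&& fits c, fits a & fits b]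
  end.

Fixpoint small_shifts (l : nat) e rho m : Prop :=
  match e with
  | Var _ | Cst _ => True
  | Bin o a b =>
    [/\ small_shifts l a rho m, small_shifts l b rho m &
        if o is OpShl then eval_expr b rho m <= 2 * l else True]
  | Fetch a => small_shifts l a rho m
  | Ite c a b =>
    [/\ small_shifts l c rho m, small_shifts l a rho m & small_shifts l b rho m]
  end.

Lemma fits_width e : fits e -> width e <= word_width.
Proof. by case: e => [x|v|o a b|a|c a b] /andP[]. Qed.

Variable l : nat.
Hypothesis l_gt0 : 0 < l.

Lemma leq_exp2_width x a b : x < 2 ^ (l * a) -> a <= b -> x < 2 ^ (l * b).
Proof.
move=> lt_x le_ab; apply: leq_trans lt_x _.
by rewrite leq_exp2l // leq_mul2l le_ab orbT.
Qed.

Lemma bool_lt_width (c : bool) : c < 2 ^ (l * 1).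
Proof. by rewrite muln1 (leq_ltn_trans (leq_b1 c)) // -{1}(expn0 2) ltn_exp2l. Qed.

Lemma eval_binop_lt o x y a b :
  x < 2 ^ (l * a) -> y < 2 ^ (l * b) -> (if o is OpShl then y <= 2 * l else True) ->
  eval_binop o x y < 2 ^ (l * binop_width o a b).
Proof.
move=> lt_x lt_y small_y; have max_a := leq_maxl a b; have max_b := leq_maxr a b.
case: o small_y => /= small_y.
- apply: (@leq_trans (2 ^ (l * maxn a b + 1))); last first.
    by rewrite leq_exp2l // mulnS addnC leq_add2r.
  have := leq_exp2_width lt_x max_a; have := leq_exp2_width lt_y max_b.
  by rewrite expnD expn1; lia.
- exact: leq_ltn_trans (leq_subr _ _) lt_x.
- by rewrite mulnDr expnD ltn_mul.
- exact: leq_ltn_trans (leq_div _ _) lt_x.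
- exact: leq_ltn_trans (leq_mod _ _) lt_x.
- exact: land_lt.
- exact: lor_lt (leq_exp2_width lt_x max_a) (leq_exp2_width lt_y max_b).
- exact: lxor_lt (leq_exp2_width lt_x max_a) (leq_exp2_width lt_y max_b).
- rewrite shiftlE mulnDr expnD (@leq_trans (2 ^ (l * a) * 2 ^ y)) //.
    by rewrite ltn_mul2r lt_x expn_gt0.
  by rewrite leq_mul2l leq_exp2l // [l * 2]mulnC small_y ?orbT.
- exact: shiftr_lt.
- exact: bool_lt_width.
- exact: bool_lt_width.
Qed.

Lemma eval_expr_lt rho m :
  (forall x, rho x < cell_bound l) -> (forall a, m a < cell_bound l) ->
  forall e, small_shifts l e rho m -> eval_expr e rho m < 2 ^ (l * width e).
Proof.
move=> lt_rho lt_m; elim=> [x|v|o a IHa b IHb|a IHa|c IHc a IHa b IHb] //=.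
- by move=> _; apply: leq_trans (ltn_expl v (ltnSn 1)) _; rewrite leq_exp2l // leq_pmull.
- by case=> /IHa lt_a /IHb lt_b; apply: eval_binop_lt.
- case=> _ /IHa lt_a /IHb lt_b; case: ifP => _.
    exact: leq_exp2_width lt_b (leq_maxr _ _).
  exact: leq_exp2_width lt_a (leq_maxl _ _).
Qed.

End Expressions.

Section Compilation.
Variables (V : finType) (K l w : nat).
Hypotheses (l_gt0 : 0 < l) (lw : l * word_width <= w).
Implicit Types (e : expr V) (rho : V -> nat) (m : nat -> nat).

Definition var_reg (x : V) : nat := K + enum_rank x.
Definition tmp_reg : nat := K + #|V|.

Fixpoint compile_expr e (d : nat) : cmd :=
  match e with
  | Var x => Op OpOr d (var_reg x) (var_reg x)
  | Cst v => Const d v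
  | Bin o a b => Seq (compile_expr a d) (Seq (compile_expr b d.+1) (Op o d d d.+1))
  | Fetch a => Seq (compile_expr a d) (ReadMem d d)
  | Ite c a b => Seq (compile_expr c d) (If d (compile_expr a d) (compile_expr b d))
  end.

Definition assign (x : V) e : cmd :=
  Seq (compile_expr e tmp_reg) (Op OpOr (var_reg x) tmp_reg tmp_reg).

Definition store (a e : expr V) : cmd :=
  Seq (compile_expr a tmp_reg)
    (Seq (compile_expr e tmp_reg.+1) (WriteMem tmp_reg tmp_reg.+1)).

Definition while (e : expr V) (p : cmd) : cmd :=
  Seq (compile_expr e tmp_reg) (While tmp_reg (Seq p (compile_expr e tmp_reg))).

Definition for_loop (x : V) (e : expr V) (p : cmd) : cmd :=
  Seq (assign x (Cst 0))
    (while (Var x < e)%expr (Seq p (assign x (Var x + Cst 1)%expr))).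

Fixpoint compile (p : prog V) : cmd :=
  match p with
  | Assign x e => assign x e
  | Store a e => store a e
  | Then p q => Seq (compile p) (compile q)
  | For x e p => for_loop x e (compile p)
  end.

Definition represents (s : state) rho m : Prop :=
  [/\ forall x, regs s (var_reg x) = rho x, mem s = m, forall r, r < K -> regs s r = 0,
      forall x, rho x < cell_bound l & forall a, m a < cell_bound l].

Definition wp (p : cmd) rho m (T : nat) (Q : (V -> nat) -> (nat -> nat) -> Prop) : Prop :=
  forall s, represents s rho m ->
  exists t s' rho' m', [/\ exec w p s t s', t <= T, represents s' rho' m' & Q rho' m'].

Lemma var_reg_lt x : var_reg x < tmp_reg.
Proof. by rewrite ltn_add2l ltn_ord. Qed.

Lemma var_reg_eq x y : (var_reg x == var_reg y) = (x == y).
Proof. by rewrite eqn_add2l (inj_eq val_inj) (inj_eq enum_rank_inj). Qed.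

Lemma exec_copy x y s : regs s y < 2 ^ w ->
  exec w (Op OpOr x y y) s 1 (set_reg s x (regs s y)).
Proof.
move=> lt_y; have := ExecOp (w := w) (o := OpOr) x (y := y) (z := y) (s := s).
by rewrite /= PeanoNat.Nat.lor_diag; apply.
Qed.

Lemma cell_bound_word v : v < cell_bound l -> v < 2 ^ w.
Proof.
move=> lt_v; apply: leq_trans lt_v _.
by rewrite leq_exp2l // (leq_trans _ lw) // leq_mul2l orbT.
Qed.

Definition computes rho m (q : cmd) (d T v : nat) : Prop :=
  forall s, (forall x, regs s (var_reg x) = rho x) -> mem s = m ->
  exists t s', [/\ exec w q s t s', t <= T, regs s' d = v,
    forall r, r < d -> regs s' r = regs s r & mem s' = m].

Section Computes.
Variables (rho : V -> nat) (m : nat -> nat) (d : nat).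
Hypothesis le_d : tmp_reg <= d.
Notation computes := (computes rho m).

Lemma var_reg_preserved s s' : (forall r, r < d -> regs s' r = regs s r) ->
  (forall x, regs s (var_reg x) = rho x) -> forall x, regs s' (var_reg x) = rho x.
Proof. by move=> keep Rs x; rewrite keep ?Rs // (leq_trans (var_reg_lt x)). Qed.

Lemma computes_var x : rho x < 2 ^ w -> computes (compile_expr (Var x) d) d 1 (rho x).
Proof.
move=> lt_x s Rs Ms; exists 1, (set_reg s d (rho x)).
split=> //= [||r lt_r]; last by rewrite upd_other // ltn_eqF.
- by rewrite -Rs; apply: exec_copy; rewrite Rs.
- by rewrite upd_same.
Qed.

Lemma computes_cst v : v < 2 ^ w -> computes (Const d v) d 1 v.
Proof.
move=> lt_v s Rs Ms; exists 1, (set_reg s d v).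
split=> //= [||r lt_r]; last by rewrite upd_other // ltn_eqF.
- exact: ExecConst.
- by rewrite upd_same.
Qed.

Lemma computes_bin o p q T1 T2 x y : eval_binop o x y < 2 ^ w ->
  computes p d T1 x -> computes q d.+1 T2 y ->
  computes (Seq p (Seq q (Op o d d d.+1))) d (T1 + (T2 + 1)) (eval_binop o x y).
Proof.
move=> lt_v cp cq s Rs Ms.
have [t1 [s1 [E1 le1 V1 keep1 M1]]] := cp s Rs Ms.
have [t2 [s2 [E2 le2 V2 keep2 M2]]] := cq s1 (var_reg_preserved keep1 Rs) M1.
have eo : eval_binop o (regs s2 d) (regs s2 d.+1) = eval_binop o x y.
  by rewrite V2 keep2 ?V1.
exists (t1 + (t2 + 1)), (set_reg s2 d (eval_binop o (regs s2 d) (regs s2 d.+1))).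
split; [|by lia|by rewrite /= upd_same|move=> r lt_r|by []].
  by apply: ExecSeq E1 (ExecSeq E2 _); apply: ExecOp; rewrite eo.
by rewrite /= upd_other ?ltn_eqF // keep2 ?keep1 // ltnW.
Qed.

Lemma computes_fetch p T a : m a < 2 ^ w -> computes p d T a ->
  computes (Seq p (ReadMem d d)) d (T + 1) (m a).
Proof.
move=> lt_a cp s Rs Ms; have [t1 [s1 [E1 le1 V1 keep1 M1]]] := cp s Rs Ms.
have read : mem s1 (regs s1 d) = m a by rewrite M1 V1.
exists (t1 + 1), (set_reg s1 d (mem s1 (regs s1 d))).
split; [|by lia|by rewrite /= upd_same|move=> r lt_r|by []].
  by apply: ExecSeq E1 _; apply: ExecReadMem; rewrite read.
by rewrite /= upd_other ?keep1 // ltn_eqF.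
Qed.

Lemma computes_ite p q r T T1 T2 z x y :
  computes p d T z -> computes q d T1 x -> computes r d T2 y ->
  computes (Seq p (If d q r)) d (T + (maxn T1 T2).+1) (if z == 0 then y else x).
Proof.
move=> cp cq cr s Rs Ms; have [t1 [s1 [E1 le1 V1 keep1 M1]]] := cp s Rs Ms.
have Rs1 := var_reg_preserved keep1 Rs.
case: eqP => [z0|z_neq0].
- have [t2 [s2 [E2 le2 V2 keep2 M2]]] := cr s1 Rs1 M1.
  exists (t1 + t2.+1), s2; split=> // [||x' lt_x]; [|by lia|by rewrite keep2 ?keep1].
  by apply: ExecSeq E1 _; apply: ExecIfFalse; rewrite ?V1.
- have [t2 [s2 [E2 le2 V2 keep2 M2]]] := cq s1 Rs1 M1.
  exists (t1 + t2.+1), s2; split=> // [||x' lt_x]; [|by lia|by rewrite keep2 ?keep1].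
  by apply: ExecSeq E1 _; apply: ExecIfTrue; rewrite ?V1.
Qed.

End Computes.

Lemma compile_expr_computes rho m :
  (forall x, rho x < cell_bound l) -> (forall a, m a < cell_bound l) ->
  forall e, fits e -> small_shifts l e rho m -> forall d, tmp_reg <= d ->
  computes rho m (compile_expr e d) d (cost e) (eval_expr e rho m).
Proof.
move=> lt_rho lt_m.
have word_value e : fits e -> small_shifts l e rho m -> eval_expr e rho m < 2 ^ w.
  move=> fit_e small_e; apply: leq_trans (eval_expr_lt l_gt0 lt_rho lt_m small_e) _.
  by rewrite leq_exp2l // (leq_trans _ lw) // leq_mul2l fits_width ?orbT.
elim=> [x|v|o a IHa b IHb|a IHa|c IHc a IHa b IHb] fit small d le_d;
  have lt_v := word_value _ fit small; case/andP: fit => _ fit.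
- exact: computes_var.
- exact: computes_cst.
- case/andP: fit => fit_a fit_b; case: small => small_a small_b _.
  by apply: computes_bin => //; [apply: IHa | apply: IHb; rewrite ?leqW].
- by apply: computes_fetch => //; apply: IHa.
- case/and3P: fit => fit_c fit_a fit_b; case: small => small_c small_a small_b.
  by apply: (computes_ite le_d); [apply: IHc | apply: IHa | apply: IHb].
Qed.

Lemma represents_compile_expr e rho m s : fits e -> small_shifts l e rho m ->
  represents s rho m -> exists t s', [/\ exec w (compile_expr e tmp_reg) s t s',
    t <= cost e, regs s' tmp_reg = eval_expr e rho m & represents s' rho m].
Proof.
move=> fit_e small_e [Rs Ms zero lt_rho lt_m].
have [t [s' [E le_t val keep M]]] :=
  compile_expr_computes lt_rho lt_m fit_e small_e (leqnn _) Rs Ms.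
exists t, s'; split=> //; split=> // [x|r lt_r]; first by rewrite keep ?var_reg_lt.
by rewrite keep ?zero // ltn_addr.
Qed.

Lemma wp_weaken p rho m T T' (Q Q' : (V -> nat) -> (nat -> nat) -> Prop) :
  wp p rho m T Q -> T <= T' -> (forall rho' m', Q rho' m' -> Q' rho' m') ->
  wp p rho m T' Q'.
Proof.
move=> wp_p le_T QQ' s /wp_p[t [s' [rho' [m' [E le_t R q]]]]].
by exists t, s', rho', m'; split=> //; [apply: leq_trans le_T | apply: QQ'].
Qed.

Lemma wp_time p rho m T T' Q : wp p rho m T Q -> T <= T' -> wp p rho m T' Q.
Proof. by move=> wp_p le_T; apply: wp_weaken wp_p le_T _. Qed.

Lemma wp_bounds p rho m T Q :
  ((forall x, rho x < cell_bound l) -> (forall a, m a < cell_bound l) ->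
     wp p rho m T Q) -> wp p rho m T Q.
Proof. by move=> wp_p s R; have [_ _ _ lt_rho lt_m] := R; apply: wp_p. Qed.

Lemma wp_seq p q rho m T1 T2 Q :
  wp p rho m T1 (fun rho' m' => wp q rho' m' T2 Q) ->
  wp (Seq p q) rho m (T1 + T2) Q.
Proof.
move=> wp_p s /wp_p[t1 [s1 [rho1 [m1 [E1 le1 R1 wp_q]]]]].
have [t2 [s2 [rho2 [m2 [E2 le2 R2 q2]]]]] := wp_q _ R1.
by exists (t1 + t2), s2, rho2, m2; split=> //; [apply: ExecSeq E1 E2 | apply: leq_add].
Qed.

Lemma wp_then p q rho m T1 T2 (P Q : (V -> nat) -> (nat -> nat) -> Prop) :
  wp p rho m T1 P -> (forall rho' m', P rho' m' -> wp q rho' m' T2 Q) ->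
  wp (Seq p q) rho m (T1 + T2) Q.
Proof. by move=> wp_p wp_q; apply: wp_seq; apply: wp_weaken wp_p (leqnn _) wp_q. Qed.

Lemma wp_assign x e rho m (Q : (V -> nat) -> (nat -> nat) -> Prop) :
  fits e -> small_shifts l e rho m -> eval_expr e rho m < cell_bound l ->
  Q (set_var rho x (eval_expr e rho m)) m -> wp (assign x e) rho m (cost e + 1) Q.
Proof.
move=> fit_e small_e lt_v q s R; have [_ _ _ lt_rho lt_m] := R.
have [t [s1 [E le_t V1 [Rs Ms zero _ _]]]] := represents_compile_expr fit_e small_e R.
exists (t + 1), (set_reg s1 (var_reg x) (regs s1 tmp_reg)),
  (set_var rho x (eval_expr e rho m)), m; split=> //; last 1 first.
- split=> //= [y|r lt_r|y].
  + by rewrite /upd /set_var var_reg_eq V1 Rs.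
  + by rewrite upd_other ?zero // ltn_eqF // ltn_addr.
  + by rewrite /set_var; case: ifP.
- by apply: ExecSeq E _; apply: exec_copy; rewrite V1 cell_bound_word.
- by rewrite leq_add2r.
Qed.

Lemma wp_store a e rho m (Q : (V -> nat) -> (nat -> nat) -> Prop) :
  fits a -> fits e -> small_shifts l a rho m -> small_shifts l e rho m ->
  eval_expr e rho m < cell_bound l ->
  Q rho (upd m (eval_expr a rho m) (eval_expr e rho m)) ->
  wp (store a e) rho m (cost a + (cost e + 1)) Q.
Proof.
move=> fit_a fit_e small_a small_e lt_v q s R; have [_ _ _ lt_rho lt_m] := R.
have [t1 [s1 [E1 le1 V1 [Rs Ms zero _ _]]]] := represents_compile_expr fit_a small_a R.
have [t2 [s2 [E2 le2 V2 keep2 M2]]] :=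
  compile_expr_computes lt_rho lt_m fit_e small_e (leqnSn _) Rs Ms.
exists (t1 + (t2 + 1)), (set_mem s2 (regs s2 tmp_reg) (regs s2 tmp_reg.+1)), rho,
  (upd m (eval_expr a rho m) (eval_expr e rho m)); split=> //.
- by apply: ExecSeq E1 (ExecSeq E2 _); apply: ExecWriteMem.
- by lia.
- split=> //= [x||r lt_r|b].
  + by rewrite keep2 ?Rs // ltnW // ltnS var_reg_lt.
  + by rewrite V2 keep2 // V1 M2.
  + by rewrite keep2 ?zero // ltnW // ltnS ltn_addr.
  + by rewrite /upd; case: ifP.
Qed.

Lemma wp_while n (I : nat -> (V -> nat) -> (nat -> nat) -> Prop) (Tb : nat -> nat) e p rho m
    (Q : (V -> nat) -> (nat -> nat) -> Prop) :
  fits e -> (forall rho' m', small_shifts l e rho' m') -> I 0 rho m ->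
  (forall i rho' m', i < n -> I i rho' m' ->
     eval_expr e rho' m' <> 0 /\ wp p rho' m' (Tb i) (I i.+1)) ->
  (forall rho' m', I n rho' m' -> eval_expr e rho' m' = 0 /\ Q rho' m') ->
  wp (while e p) rho m (\sum_(0 <= i < n) (Tb i + cost e + 1) + cost e + 1) Q.
Proof.
move=> fit_e small_e I0 step final s R.
have [t0 [s0 [E0 le0 V0 R0]]] := represents_compile_expr fit_e (small_e _ _) R.
suff iterate d i rho1 m1 s1 : i + d = n -> I i rho1 m1 -> represents s1 rho1 m1 ->
    regs s1 tmp_reg = eval_expr e rho1 m1 ->
    exists t s' rho' m',
      [/\ exec w (While tmp_reg (Seq p (compile_expr e tmp_reg))) s1 t s',
        t <= \sum_(i <= j < n) (Tb j + cost e + 1) + 1, represents s' rho' m' & Q rho' m'].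
  have [t [s' [rho' [m' [E le_t R' q]]]]] := iterate n 0 rho m s0 (add0n n) I0 R0 V0.
  by exists (t0 + t), s', rho', m'; split=> //; [apply: ExecSeq E0 E | lia].
elim: d i rho1 m1 s1 => [|d IH] i rho1 m1 s1 eq_n Ii R1 V1.
  rewrite addn0 in eq_n; rewrite eq_n in Ii *; have [e0 q] := final _ _ Ii.
  exists 1, s1, rho1, m1; split=> //; last by rewrite big_geq.
  by apply: ExecWhileFalse; rewrite V1.
have lt_i : i < n by lia.
have [nz body] := step _ _ _ lt_i Ii.
have [t2 [s2 [rho2 [m2 [E2 le2 R2 I2]]]]] := body _ R1.
have [t3 [s3 [E3 le3 V3 R3]]] := represents_compile_expr fit_e (small_e _ _) R2.
have [|t4 [s4 [rho4 [m4 [E4 le4 R4 q4]]]]] := IH i.+1 rho2 m2 s3 _ I2 R3 V3; first by lia.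
exists (t2 + t3 + t4).+1, s4, rho4, m4; split=> //; last by rewrite big_ltn //; lia.
by apply: ExecWhileTrue E4; [rewrite V1 | apply: ExecSeq E2 E3].
Qed.

Lemma wp_for n (I : nat -> (V -> nat) -> (nat -> nat) -> Prop) (Tb : nat -> nat) x e p rho m
    (Q : (V -> nat) -> (nat -> nat) -> Prop) :
  fits e -> (forall rho' m', small_shifts l e rho' m') -> n < cell_bound l ->
  I 0 (set_var rho x 0) m ->
  (forall i rho' m', I i rho' m' -> rho' x = i /\ eval_expr e rho' m' = n) ->
  (forall i rho' m', i < n -> I i rho' m' ->
     wp p rho' m' (Tb i) (fun rho'' m'' =>
       rho'' x = i /\ I i.+1 (set_var rho'' x i.+1) m'')) ->
  (forall rho' m', I n rho' m' -> Q rho' m') ->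
  wp (for_loop x e p) rho m (\sum_(0 <= i < n) (Tb i + cost e + 7) + cost e + 5) Q.
Proof.
move=> fit_e small_e lt_n I0 Ix step final.
apply: (wp_time (T := (1 + 1) + (\sum_(0 <= i < n) (Tb i + 4 + cost (Var x < e)%expr + 1)
    + cost (Var x < e)%expr + 1))); last first.
  rewrite /= (eq_bigr (fun i => Tb i + cost e + 7)) => [|i _]; last by lia.
  by lia.
apply/wp_seq/wp_assign => //; first by rewrite expn_gt0.
apply: (@wp_while n I (fun i => Tb i + 4)) => //.
- move=> i rho' m' lt_i Ii; have [x_i eval_e] := Ix _ _ _ Ii; rewrite /= x_i eval_e lt_i.
  split=> //; apply: wp_seq; apply: wp_weaken (step _ _ _ lt_i Ii) (leqnn _) _.
  move=> rho2 m2 [x2 I2]; apply: wp_assign => //=.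
    by rewrite x2 addn1 (leq_ltn_trans lt_i).
  by rewrite x2 addn1.
- move=> rho' m' In; have [x_n eval_e] := Ix _ _ _ In.
  by rewrite /= x_n eval_e ltnn; split=> //; apply: final.
Qed.

End Compilation.

(** * The reduction program *)

Variant param : Type :=
  | NumVars | NumClauses | HalfVars | MaskBase | LogRows
  | NumRows | TableBase | InstanceBase | NumHalves | AlphabetSize.

Variant local : Type :=
  | Ptr | Clause | Length | Index | Lit | Side
  | Half | Row | Symbol | Mult | Count | Offset.

Definition all_params : seq param :=
  [:: NumVars; NumClauses; HalfVars; MaskBase; LogRows;
      NumRows; TableBase; InstanceBase; NumHalves; AlphabetSize].

Definition all_locals : seq local :=
  [:: Ptr; Clause; Length; Index; Lit; Side; Half; Row; Symbol; Mult; Count; Offset].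

Definition param_code (x : param) : nat :=
  match x with
  | NumVars => 0 | NumClauses => 1 | HalfVars => 2 | MaskBase => 3 | LogRows => 4
  | NumRows => 5 | TableBase => 6 | InstanceBase => 7 | NumHalves => 8 | AlphabetSize => 9
  end.

Definition local_code (x : local) : nat :=
  match x with
  | Ptr => 0 | Clause => 1 | Length => 2 | Index => 3 | Lit => 4 | Side => 5
  | Half => 6 | Row => 7 | Symbol => 8 | Mult => 9 | Count => 10 | Offset => 11
  end.

Lemma param_codeK : pcancel param_code (onth all_params). Proof. by case. Qed.
Lemma local_codeK : pcancel local_code (onth all_locals). Proof. by case. Qed.

HB.instance Definition _ := Countable.copy param (pcan_type param_codeK).
HB.instance Definition _ := Countable.copy local (pcan_type local_codeK).

Lemma all_params_enum : Finite.axiom all_params. Proof. by case. Qed.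
Lemma all_locals_enum : Finite.axiom all_locals. Proof. by case. Qed.

HB.instance Definition _ := fintype.isFinite.Build param all_params_enum.
HB.instance Definition _ := fintype.isFinite.Build local all_locals_enum.

Definition var : Type := (param + local)%type.

HB.instance Definition _ := Finite.on var.

Definition var_of_param (x : param) : var := inl x.
Definition var_of_local (x : local) : var := inr x.
Definition expr_of_var (x : var) : expr var := Var x.
Definition expr_of_nat (n : nat) : expr var := Cst n.
Coercion var_of_param : param >-> var.
Coercion var_of_local : local >-> var.
Coercion expr_of_var : var >-> expr.
Coercion expr_of_nat : nat >-> expr.

(** ** Memory layout *)

Definition mask_base (N M : nat) : nat := 2 + M * (2 * N + 1).
Definition table_base (N M : nat) : nat := mask_base N M + 2 * M.
Definition instance_base (N M : nat) : nat := table_base N M + 2 * (2 ^ log_rows N M * M).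
Definition side_size (N M : nat) : nat :=
  3 * (log_rows N M * (6 * M) + M) * 2 ^ log_rows N M.

Definition table_cell (N M s i c : nat) : nat :=
  table_base N M + ((s * 2 ^ log_rows N M + i) * M + c).

Definition param_value (N M : nat) (x : param) : nat :=
  match x with
  | NumVars => N
  | NumClauses => M
  | HalfVars => half_vars N
  | MaskBase => mask_base N M
  | LogRows => log_rows N M
  | NumRows => 2 ^ log_rows N M
  | TableBase => table_base N M
  | InstanceBase => instance_base N M
  | NumHalves => 2 ^ half_vars N
  | AlphabetSize => alphabet_size (log_rows N M) M
  end.

Lemma table_cell_inj N M s i c s' i' c' :
  i < 2 ^ log_rows N M -> i' < 2 ^ log_rows N M -> c < M -> c' < M ->
  table_cell N M s i c = table_cell N M s' i' c' -> [/\ s = s', i = i' & c = c'].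
Proof.
move=> lt_i lt_i' lt_c lt_c' /addnI eq_cell.
have divmod_inj d x y x' y' : y < d -> y' < d -> x * d + y = x' * d + y' ->
    x = x' /\ y = y'.
  move=> lt_y lt_y' eq_xy; have d_gt0 : 0 < d by lia.
  have := congr1 (divn^~ d) eq_xy; have := congr1 (modn^~ d) eq_xy.
  by rewrite /= !divnMDl // !modnMDl !modn_small // !divn_small // !addn0.
have [eq_si ->] := divmod_inj _ _ _ _ _ lt_c lt_c' eq_cell.
by have [-> ->] := divmod_inj _ _ _ _ _ lt_i lt_i' eq_si.
Qed.

Lemma table_cell_lt N M s i c : s < 2 -> i < 2 ^ log_rows N M -> c < M ->
  table_cell N M s i c < instance_base N M.
Proof.
move=> lt_s lt_i lt_c; rewrite /table_cell /instance_base ltn_add2l.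
apply: (@leq_trans ((s * 2 ^ log_rows N M + i).+1 * M)); first by rewrite mulSnr ltn_add2l.
by rewrite mulnA leq_mul2r; apply/orP; right; case: s lt_s => [|[|]] // _; lia.
Qed.

(* Every number that the program computes is bounded by a polynomial of degree 3 in
   [2 ^ l]. *)
Lemma memory_fits l N M : N < l -> M < 2 ^ l ->
  instance_base N M + 2 * side_size N M + 12 * (M * 2 ^ log_rows N M)
    + 4 * 2 ^ half_vars N + 6 * M + 4 < cell_bound l.
Proof.
move=> lt_Nl lt_Ml; set X := 2 ^ l; set H := 2 ^ log_rows N M; set P := 2 ^ half_vars N.
have le_PX : P <= X by rewrite leq_exp2l //; have := half_vars_le N; lia.
have le_HX : H <= X by apply: leq_trans le_PX; rewrite leq_exp2l // log_rows_le_half.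
have lt_NX : N < X by apply: ltn_trans (ltn_expl N (ltnSn 1)) _; rewrite ltn_exp2l.
have X_ge2 : 2 <= X by rewrite -[2]expn1 leq_exp2l //; lia.
have le_kM := log_rows_le_clauses N M.
have -> : cell_bound l = X * X * X * X ^ 13 by rewrite /cell_bound expnM !expnS; ring.
apply: (@leq_trans (X * X * X * 128)); last first.
  rewrite leq_mul2l -[128]/(2 ^ 7); apply/orP; right.
  by apply: (@leq_trans (2 ^ 13)); rewrite ?leq_exp2l ?leq_exp2r.
have MN_le : M * (2 * N + 1) <= X * (2 * X) by apply: leq_mul; lia.
have HM_le : H * M <= X * X by apply: leq_mul => //; lia.
have kM_le : log_rows N M * (6 * M) <= X * (6 * X) by apply: leq_mul; lia.
have sizes_le : (log_rows N M * (6 * M) + M) * H <= 7 * (X * X) * X.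
  by apply: leq_mul => //; nia.
have X2_le : 2 * X <= X * X by rewrite leq_mul2r X_ge2 orbT.
have X3_le : 2 * (X * X) <= X * X * X by rewrite mulnC leq_mul2l X_ge2 orbT.
rewrite /instance_base /table_base /mask_base /side_size -/H -[3 * _ * _]mulnA [M * H]mulnC.
rewrite [X * (2 * X)]mulnCA in MN_le.
rewrite -[7 * _ * _]mulnA in sizes_le.
move: (X * X * X) (X * X) (H * M) (_ * H) (M * _) MN_le HM_le sizes_le X2_le X3_le.
by move: (H) (P) le_HX le_PX; lia.
Qed.

Lemma side_size_le N M : side_size N M <= 21 * (M.+1 ^ 2 * 2 ^ half_vars N).
Proof.
have kM_le : log_rows N M * (6 * M) <= M * (6 * M).
  by rewrite leq_mul2r log_rows_le_clauses orbT.
rewrite /side_size [leqRHS]mulnA; apply: leq_mul; first by rewrite -mulnn; lia.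
by rewrite leq_exp2l // log_rows_le_half.
Qed.

Definition build_time (N M : nat) : nat := 100 * (100 * (M.+1 ^ 2 * 2 ^ half_vars N)).

Lemma build_time_bound N M :
  100 + ((M * (140 * N + 40) + 20) + ((2 * (2 ^ half_vars N * (M * 200 + 100)) + 60)
    + ((2 * (25 * side_size N M
        + 2 ^ log_rows N M * (alphabet_size (log_rows N M) M * 308 + 20)) + 100) + 20)))
  <= build_time N M.
Proof.
set H := 2 ^ log_rows N M; set P := 2 ^ half_vars N.
have P_gt0 : 0 < P by rewrite expn_gt0.
have le_HP : H <= P by rewrite leq_exp2l // log_rows_le_half.
have le_NP : N <= 2 * P.
  by move: (ltn_expl (half_vars N) (ltnSn 1)); rewrite -/P /half_vars; lia.
have le_kM := log_rows_le_clauses N M.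
have parse_le : M * (140 * N + 40) <= M * (320 * P).
  by rewrite leq_mul2l; apply/orP; right; lia.
have size_le : side_size N M <= 21 * (M.+1 ^ 2 * P) := side_size_le N M.
have emit_le : H * (alphabet_size (log_rows N M) M * 308 + 20) <= P * (M * 1848 + 20).
  by apply: leq_mul => //; rewrite leq_add2r /alphabet_size; lia.
have square_le : M.+1 * P <= M.+1 ^ 2 * P by rewrite leq_mul2r expnS leq_pmulr ?orbT.
by rewrite /build_time -/P; move: (M.+1 ^ 2 * P) square_le size_le; lia.
Qed.

(** ** Program text *)

Definition init_prog : prog var := (
  NumVars ::= Fetch 0;;
  NumClauses ::= Fetch 1;;
  HalfVars ::= (NumVars + 1) %/ 2;;
  MaskBase ::= 2 + NumClauses * (2 * NumVars + 1);;
  LogRows ::= Ite (HalfVars < NumClauses) HalfVars NumClauses;;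
  NumRows ::= 1 shl LogRows;;
  TableBase ::= MaskBase + 2 * NumClauses;;
  InstanceBase ::= TableBase + 2 * (NumRows * NumClauses);;
  NumHalves ::= 1 shl HalfVars;;
  AlphabetSize ::= 2 * (2 * LogRows + NumClauses))%prog.

Definition mask_addr (c b : expr var) : expr var := (MaskBase + (2 * c + b))%expr.

Definition parse_literal_prog : prog var := (
  Lit ::= Fetch Ptr;;
  mem[ mask_addr Clause (Lit %% 2) ] ::=
    Fetch (mask_addr Clause (Lit %% 2)) || (1 shl (Lit %/ 2));;
  Ptr ::= Ptr + 1)%prog.

Definition parse_clause_prog : prog var := (
  Length ::= Fetch Ptr;;
  Ptr ::= Ptr + 1;;
  for Index < Length do parse_literal_prog)%prog.

Definition parse_prog : prog var := (
  Ptr ::= 2;;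
  for Clause < NumClauses do parse_clause_prog)%prog.

Definition sat_expr : expr var :=
  (0 < ((Fetch (mask_addr Clause 1) && (Half shl (Side * HalfVars)))
    || (Fetch (mask_addr Clause 0)
        && (Bin OpXor Half (NumHalves - 1) shl (Side * HalfVars)))))%expr.

Definition table_addr (i c : expr var) : expr var :=
  (TableBase + ((Side * NumRows + i) * NumClauses + c))%expr.

Definition row_index_prog : prog var := (
  Row ::= Ite (NumClauses < HalfVars) 0 Half;;
  for Clause < Ite (NumClauses < HalfVars) NumClauses 0 do
    Row ::= 2 * Row + sat_expr)%prog.

Definition table_half_prog : prog var := (
  row_index_prog;;
  for Clause < NumClauses do mem[ table_addr Row Clause ] ::= sat_expr)%prog.

Definition table_prog : prog var :=
  (for Side < 2 do for Half < NumHalves do table_half_prog)%prog.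

Definition separator_expr (lv i b : expr var) : expr var :=
  let r := (LogRows - (lv + 1))%expr in
  (6 * NumClauses
    * Ite b ((i %% (1 shl r) == 0) * (1 shl r))
        ((i %% (1 shl (r + 1)) == (1 shl r)) * (1 shl r)))%expr.

Definition clause_expr (t b : expr var) : expr var := Ite b (2 * t)%expr (3 - 2 * t)%expr.

Definition runs_expr : expr var :=
  let p := (Symbol %/ 2)%expr in let b := ((Symbol + Side) %% 2)%expr in
  Ite (p < LogRows)%expr (separator_expr p Row b)
    (Ite (p < LogRows + NumClauses)%expr
      (clause_expr (Fetch (table_addr Row (p - LogRows)%expr)) b)
      (separator_expr (2 * LogRows + NumClauses - (p + 1)) (NumRows - (Row + 1)) b)).

Definition emit_run_prog : prog var := (
  Mult ::= runs_expr;;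
  for Count < Mult do (mem[ Ptr ] ::= Symbol;; Ptr ::= Ptr + 1))%prog.

Definition emit_prog : prog var := (
  mem[ InstanceBase ] ::= 3 * (LogRows * (6 * NumClauses) + NumClauses) * NumRows;;
  Ptr ::= InstanceBase + 1;;
  for Side < 2 do for Row < NumRows do for Symbol < AlphabetSize do emit_run_prog)%prog.

Definition build_prog : prog var := (
  init_prog;;
  parse_prog;;
  table_prog;;
  emit_prog;;
  Offset ::= 12 * (NumClauses * (NumRows - 1)))%prog.

(** ** Verification *)

Section Verification.
Variables (K l w N : nat) (F : cnf N).
Local Notation M := (size F).
Hypotheses (wf_F : wf_cnf F) (lw : l * word_width <= w) (lt_Nl : N < l) (lt_Ml : M < 2 ^ l).

Let l_gt0 : 0 < l. Proof. exact: leq_trans lt_Nl. Qed.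

Local Notation wp p rho m T Q :=
  (wp K l w (compile K p) rho m T (Q : (var -> nat) -> (nat -> nat) -> Prop)).
Local Notation k := (log_rows N M).
Local Notation H := (2 ^ k).
Local Notation value := (param_value N M).

Definition params (rho : var -> nat) : Prop := forall x : param, rho x = value x.

Definition keeps (xs : seq local) (rho rho' : var -> nat) : Prop :=
  forall x : local, x \in xs -> rho' x = rho x.

Lemma keeps_trans xs rho1 rho2 rho3 :
  keeps xs rho1 rho2 -> keeps xs rho2 rho3 -> keeps xs rho1 rho3.
Proof. by move=> kept12 kept23 x x_in; rewrite kept23 ?kept12. Qed.

Lemma keeps_sub xs ys rho rho' : all [in ys] xs -> keeps ys rho rho' -> keeps xs rho rho'.
Proof. by move=> /allP sub_xs kept x /sub_xs; apply: kept. Qed.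

Lemma keeps_set_var xs rho rho' (x : local) v : x \notin xs ->
  keeps xs rho rho' -> keeps xs rho (set_var rho' (x : var) v).
Proof.
move=> x_notin kept y y_in; rewrite /set_var.
by case: eqP => [[eq_yx]|_]; [rewrite -eq_yx y_in in x_notin | apply: kept].
Qed.

Lemma param_value_lt x : value x < cell_bound l.
Proof.
have room := memory_fits lt_Nl lt_Ml.
have lt_h : half_vars N < 2 ^ half_vars N := ltn_expl _ (ltnSn 1).
have le_HP : H <= 2 ^ half_vars N by rewrite leq_exp2l // log_rows_le_half.
have le_kM := log_rows_le_clauses N M; have le_kh := log_rows_le_half N M.
case: x => /=; rewrite /alphabet_size /instance_base /table_base in room *; try lia.
by move: lt_h; rewrite /half_vars in room *; lia.
Qed.

Lemma two_lt_cell_bound : 2 < cell_bound l.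
Proof. exact: leq_ltn_trans (leq_addr _ _) (param_value_lt MaskBase). Qed.

Lemma double_vars_lt : 2 * N < cell_bound l.
Proof.
move: (memory_fits lt_Nl lt_Ml) (ltn_expl (half_vars N) (ltnSn 1)).
by rewrite {2}/half_vars; lia.
Qed.

Lemma wp_set_param (x : param) e rho m (Q : (var -> nat) -> (nat -> nat) -> Prop) :
  fits e -> small_shifts l e rho m -> eval_expr e rho m = value x ->
  Q (set_var rho (x : var) (value x)) m -> wp (Assign (x : var) e) rho m (cost e + 1) Q.
Proof.
by move=> fit_e small_e val_e q; apply: wp_assign; rewrite ?val_e ?param_value_lt.
Qed.

Lemma wp_init (rho : var -> nat) : wp init_prog rho (nth 0 (encode_cnf F)) 100
  (fun rho' m => params rho' /\ m = nth 0 (encode_cnf F)).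
Proof.
have le_h2l : half_vars N <= 2 * l by have := half_vars_le N; lia.
have le_k2l : k <= 2 * l := leq_trans (log_rows_le_half N M) le_h2l.
rewrite /init_prog; eapply wp_time.
  eapply wp_seq; apply: wp_set_param => //=.
  eapply wp_seq; apply: wp_set_param => //=.
  eapply wp_seq; apply: wp_set_param => //=.
  eapply wp_seq; apply: wp_set_param => //=.
  eapply wp_seq; apply: wp_set_param => //=.
    by rewrite /set_var /= /log_rows /minn; case: ltnP.
  eapply wp_seq; apply: wp_set_param => //=; first by rewrite shiftlE mul1n.
  eapply wp_seq; apply: wp_set_param => //=.
  eapply wp_seq; apply: wp_set_param => //=.
  eapply wp_seq; apply: wp_set_param => //=; first by rewrite shiftlE mul1n.
  apply: wp_set_param => //=; split=> //; by case.
by [].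
Qed.

Local Notation lits c := (nth [::] F c).

Definition clause_pos (c : nat) : nat :=
  2 + size (flatten (map (@encode_clause N) (take c F))).

Lemma clause_posS c : c < M -> clause_pos c.+1 = clause_pos c + (size (lits c)).+1.
Proof.
move=> lt_c; rewrite /clause_pos (take_nth [::]) // map_rcons.
by rewrite flatten_rcons size_cat /= size_map addnA.
Qed.

Lemma size_clause_le c : size (lits c) <= 2 * N.
Proof.
have [lt_c|ge_c] := ltnP c M; last by rewrite nth_default.
have uniq_c : uniq (lits c) by apply: (allP wf_F); rewrite mem_nth.
rewrite -(card_uniqP uniq_c); apply: leq_trans (max_card _) _.
by rewrite card_prod card_ord card_bool mulnC.
Qed.

Lemma clause_pos_lt c x : c < M -> x <= size (lits c) -> clause_pos c + x < mask_base N M.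
Proof.
move=> lt_c le_x; apply: (@leq_trans (clause_pos c.+1)).
  by rewrite clause_posS // ltn_add2l ltnS.
elim: (c.+1) lt_c => [|d IH] lt_d; first by rewrite /clause_pos take0.
have pos_le e : e <= M -> clause_pos e <= 2 + e * (2 * N + 1).
  elim: e => [|e IHe] lt_e; first by rewrite /clause_pos take0.
  by rewrite clause_posS // mulSn; have := IHe (ltnW lt_e); have := size_clause_le e; lia.
by apply: leq_trans (pos_le _ lt_d) _; rewrite leq_add2l leq_mul2r lt_d orbT.
Qed.

Lemma nth_encode_cnf c x : c < M -> x <= size (lits c) ->
  nth 0 (encode_cnf F) (clause_pos c + x) = nth 0 (encode_clause (lits c)) x.
Proof.
move=> lt_c le_x; rewrite /encode_cnf /clause_pos add2n !addSn /=.
rewrite -{1}(cat_take_drop c F) map_cat flatten_cat nth_cat.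
rewrite ltnNge leq_addr /= addKn (drop_nth [::]) //=.
by case: x le_x => // x lt_x; rewrite /= nth_cat size_map lt_x.
Qed.

Lemma size_encode_cnf : size (encode_cnf F) <= mask_base N M.
Proof.
have -> : size (encode_cnf F) = clause_pos M by rewrite /clause_pos take_size.
case: (posnP M) => [M0|M_gt0]; first by rewrite /clause_pos M0 take0.
have := @clause_pos_lt M.-1 (size (lits M.-1)).
by rewrite -addnS -clause_posS prednK //; apply.
Qed.

Lemma encode_cnf_lt a : nth 0 (encode_cnf F) a < cell_bound l.
Proof.
have two_N := double_vars_lt; have /= ltM := param_value_lt NumClauses.
case: a => [|[|a]] /=; [by lia | by lia |].
have [lt_a|ge_a] := ltnP a (size (flatten (map (@encode_clause N) F))); last first.
  by rewrite nth_default // expn_gt0.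
have /flattenP[s /mapP[c Fc ->]] := mem_nth 0 lt_a.
rewrite inE => /orP[/eqP->|/mapP[[x b] _ ->]].
  by rewrite -(nth_index [::] Fc) (leq_ltn_trans (size_clause_le _)).
by rewrite /encode_literal /=; have := ltn_ord x; case: b; lia.
Qed.

(* The literals of clause [d] that have been read, when the program is about to read
   the [j]-th literal of clause [c]. *)
Definition literals_read (c j d : nat) : clause N :=
  if d < c then lits d else if d == c then take j (lits d) else [::].

Definition parse_memory (c j : nat) (m : nat -> nat) : Prop :=
  [/\ forall a, a < mask_base N M -> m a = nth 0 (encode_cnf F) a,
      forall d (b : bool), d < M ->
        m (mask_base N M + (2 * d + b)) = clause_mask b (literals_read c j d)
    & forall a, table_base N M <= a -> m a = 0].

Definition has_masks (m : nat -> nat) : Prop :=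
  forall d (b : bool), d < M -> m (mask_base N M + (2 * d + b)) = clause_mask b (lits d).

Lemma clause_mask_take b c j : j < size (lits c) ->
  let x := nth 0 (map (@encode_literal N) (lits c)) j in
  clause_mask b (take j.+1 (lits c)) =
    if x %% 2 == b then Nat.lor (clause_mask b (take j (lits c))) (Nat.shiftl 1 (x %/ 2))
    else clause_mask b (take j (lits c)).
Proof.
move=> lt_j; case def_c: (lits c) lt_j => [|y0 s] // lt_j.
rewrite (nth_map y0) // (take_nth y0) // /clause_mask foldl_rcons /add_to_mask.
case: (nth _ _ _) => y v; rewrite /encode_literal /=.
have -> : (2 * y + v) %% 2 = v by case: v; lia.
have -> : (2 * y + v) %/ 2 = y by case: v; lia.
by case: v; case: b.
Qed.

Lemma parse_memory0 : parse_memory 0 0 (nth 0 (encode_cnf F)).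
Proof.
have beyond a : mask_base N M <= a -> nth 0 (encode_cnf F) a = 0.
  by move=> le_a; rewrite nth_default // (leq_trans size_encode_cnf).
split=> // [d b _|a le_a].
  by rewrite beyond ?leq_addr // /literals_read; case: eqP => // _; rewrite take0.
by apply: beyond; apply: leq_trans le_a; apply: leq_addr.
Qed.

Lemma parse_memory_clause c m : parse_memory c (size (lits c)) m -> parse_memory c.+1 0 m.
Proof.
case=> input masks zero; split=> // d b lt_d; rewrite masks //.
rewrite /literals_read ltnS; case: (ltngtP d c) => [//|_|->]; last by rewrite take_size.
by case: eqP; rewrite ?take0.
Qed.

Lemma parse_memory_literal c j m : c < M -> j < size (lits c) -> parse_memory c j m ->
  let x := m (clause_pos c + j.+1) in let a := mask_base N M + (2 * c + x %% 2) in
  parse_memory c j.+1 (upd m a (Nat.lor (m a) (Nat.shiftl 1 (x %/ 2)))).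
Proof.
move=> lt_c lt_j [input masks zero] x a.
have x_read : x = nth 0 (map (@encode_literal N) (lits c)) j.
  by rewrite /x input ?clause_pos_lt // nth_encode_cnf.
have lt_x2 : x %% 2 < 2 by rewrite ltn_mod.
have lt_a : a < table_base N M by rewrite /a /table_base; lia.
split=> [b lt_b|d b lt_d|b le_b].
- by rewrite upd_other ?input // /a; lia.
- rewrite /upd eqn_add2l; have [eq_addr|ne_addr] := eqVneq (2 * d + b) (2 * c + x %% 2).
    have [def_d def_b] : d = c /\ x %% 2 = b by case: b eq_addr => /=; lia.
    rewrite /a {1}def_b masks // def_d /literals_read ltnn eqxx.
    by rewrite clause_mask_take // -x_read def_b eqxx.
  rewrite masks // /literals_read; case: ltngtP => // def_d.
  rewrite def_d clause_mask_take // -x_read ifF //.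
  by apply: contraNF ne_addr => /eqP ->; rewrite def_d.
- by rewrite upd_other ?zero //; lia.
Qed.

Lemma wp_parse_literal rho m c j : c < M -> j < size (lits c) -> params rho ->
  rho Clause = c -> rho Ptr = clause_pos c + j.+1 -> parse_memory c j m ->
  wp parse_literal_prog rho m 60 (fun rho' m' =>
    [/\ params rho', rho' Ptr = clause_pos c + j.+2, parse_memory c j.+1 m'
      & keeps [:: Clause; Length; Index] rho rho']).
Proof.
move=> lt_c lt_j par clauseE ptrE mem_j; apply: wp_bounds => _ lt_m.
have room := memory_fits lt_Nl lt_Ml.
set x := m (clause_pos c + j.+1).
have lt_x : x < 2 * N.
  have [input _ _] := mem_j; rewrite /x input ?clause_pos_lt // nth_encode_cnf //=.
  have : nth 0 (map (@encode_literal N) (lits c)) j \in map (@encode_literal N) (lits c).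
    by rewrite mem_nth ?size_map.
  by case/mapP=> -[y b] _ ->; rewrite /encode_literal /=; have := ltn_ord y; case: b; lia.
eapply wp_time.
  eapply wp_seq; apply: wp_assign => //=; rewrite ptrE -/x.
  eapply wp_seq; apply: wp_store => //=; rewrite /set_var /= ?par ?clauseE /=.
  - by do !split=> //; lia.
  - by apply: lor_lt => //; rewrite shiftlE mul1n ltn_exp2l // /cell_width; lia.
  apply: wp_assign => //=; rewrite /set_var /= ptrE.
    by have := clause_pos_lt lt_c lt_j; rewrite /instance_base /table_base in room *; lia.
  split; [exact: par | by rewrite -addnA addn1 | exact: parse_memory_literal |].
  by apply: (keeps_set_var (rho' := set_var rho (Lit : var) x)) => //; apply: keeps_set_var.
by [].
Qed.

Lemma wp_parse_clause rho m c : c < M -> params rho ->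
  rho Clause = c -> rho Ptr = clause_pos c -> parse_memory c 0 m ->
  wp parse_clause_prog rho m (140 * N + 20) (fun rho' m' =>
    [/\ params rho', rho' Clause = c, rho' Ptr = clause_pos c.+1 & parse_memory c.+1 0 m']).
Proof.
move=> lt_c par clauseE ptrE mem_c; have room := memory_fits lt_Nl lt_Ml.
have lt_pos := clause_pos_lt lt_c (leq0n _).
have lengthE : m (clause_pos c) = size (lits c).
  by have [input _ _] := mem_c; rewrite -[clause_pos c]addn0 input ?nth_encode_cnf.
have le_size := size_clause_le c.
have lt_size : size (lits c) < cell_bound l by have := double_vars_lt; lia.
eapply wp_time.
  eapply wp_seq; apply: wp_assign => //=; rewrite ptrE lengthE //.
  eapply wp_seq; apply: wp_assign => //=; rewrite /set_var /= ptrE.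
    by rewrite /instance_base /table_base in room; lia.
  pose I j (rho' : var -> nat) m' := [/\ params rho',
    [/\ rho' Clause = c, rho' Length = size (lits c) & rho' Index = j],
    rho' Ptr = clause_pos c + j.+1 & parse_memory c j m'].
  apply: (wp_for l_gt0 lw (n := size (lits c)) (I := I) (Tb := fun=> 60)) => //.
  - by move=> j rho' m' [_ [_ length' index'] _ _].
  - move=> j rho' m' lt_j [par' [clause' length' index'] ptr' mem'].
    apply: wp_weaken (wp_parse_literal lt_c lt_j par' clause' ptr' mem') (leqnn _) _.
    move=> rho2 m2 [par2 ptr2 mem2 kept]; split; first by rewrite kept.
    by split=> //; rewrite /set_var /= !kept.
  - move=> rho' m' [par' [clause' _ _] ptr' mem']; split=> //.
      by rewrite ptr' clause_posS.
    exact: parse_memory_clause.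
by rewrite sum_nat_const_nat /=; lia.
Qed.

Lemma wp_parse rho : params rho ->
  wp parse_prog rho (nth 0 (encode_cnf F)) (M * (140 * N + 40) + 20) (fun rho' m' =>
    [/\ params rho', has_masks m' & forall a, table_base N M <= a -> m' a = 0]).
Proof.
move=> par; eapply wp_time.
  eapply wp_seq; apply: wp_assign => //=; first exact: two_lt_cell_bound.
  pose I c (rho' : var -> nat) m' := [/\ params rho', rho' Clause = c,
    rho' Ptr = clause_pos c & parse_memory c 0 m'].
  apply: (wp_for l_gt0 lw (n := M) (I := I) (Tb := fun=> 140 * N + 20)) => //.
  - exact: (param_value_lt NumClauses).
  - by split=> //; [rewrite /clause_pos take0 | exact: parse_memory0].
  - by move=> c rho' m' [par' clause' _ _]; split=> //; apply: par'.
  - move=> c rho' m' lt_c [par' clause' ptr' mem'].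
    apply: wp_weaken (wp_parse_clause lt_c par' clause' ptr' mem') (leqnn _) _.
    by move=> rho2 m2 [par2 clause2 ptr2 mem2]; split.
  - move=> rho' m' [par' _ _ [_ masks zero]]; split=> // d b lt_d.
    by rewrite masks // /literals_read lt_d.
by rewrite sum_nat_const_nat /=; lia.
Qed.

Lemma half_le_shift s : s < 2 -> s * half_vars N <= 2 * l.
Proof. by have := half_vars_le N; case: s => [|[|]] //; lia. Qed.

Section SatExpr.
Variables (rho : var -> nat) (m : nat -> nat) (s a c : nat).
Hypotheses (par : params rho) (masks : has_masks m).
Hypotheses (sideE : rho Side = s) (halfE : rho Half = a) (clauseE : rho Clause = c).
Hypotheses (lt_s : s < 2) (lt_a : a < 2 ^ half_vars N) (lt_c : c < M).

Lemma eval_sat_expr : eval_expr sat_expr rho m = half_sat F s a c.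
Proof.
rewrite /= !par sideE halfE clauseE /= /half_sat -(masked_sat_gt0 _ _ lt_a) /masked_sat.
by rewrite -(masks true lt_c) -(masks false lt_c).
Qed.

Lemma small_shifts_sat_expr : small_shifts l sat_expr rho m.
Proof. by rewrite /= !par sideE /=; have := half_le_shift lt_s; do !split=> //. Qed.

End SatExpr.

(* The table when assignment [a] of side [s] is being processed and its first [c]
   clauses are done. *)
Definition halves_done (s a c s' c' : nat) : nat :=
  if s' < s then 2 ^ half_vars N else if s' == s then a + (c' < c) else 0.

Definition table_memory (s a c : nat) (m : nat -> nat) : Prop :=
  [/\ has_masks m,
    forall s' i' c', s' < 2 -> i' < H -> c' < M -> m (table_cell N M s' i' c') =
      rows_upto F (halves_done s a c s' c') s' i' c'
  & forall b, instance_base N M <= b -> m b = 0].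

Definition has_tables (m : nat -> nat) : Prop :=
  forall s i c, s < 2 -> i < H -> c < M -> m (table_cell N M s i c) = row_table F s i c.

Lemma rows_uptoS n s i c : rows_upto F n.+1 s i c =
  rows_upto F n s i c || (row_index F s n == i) && half_sat F s n c.
Proof. by rewrite /rows_upto -[n.+1]addn1 iotaD has_cat /= orbF. Qed.

Lemma rows_upto_index s a c : c < M ->
  rows_upto F a.+1 s (row_index F s a) c = half_sat F s a c.
Proof.
move=> lt_c; rewrite rows_uptoS eqxx /=; apply/orP/idP => [[/hasP[b _]|//]|]; last by right.
by case/andP=> /eqP/row_index_inj ->.
Qed.

Lemma table_memory0 m : has_masks m -> (forall b, table_base N M <= b -> m b = 0) ->
  table_memory 0 0 0 m.
Proof.
move=> masks zero; split=> // [s i c _ _ _|b le_b].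
  by rewrite zero ?leq_addr // /halves_done !ltn0; case: eqP.
by apply: zero; apply: leq_trans le_b; apply: leq_addr.
Qed.

Lemma table_memory_half s a m : table_memory s a M m -> table_memory s a.+1 0 m.
Proof.
case=> masks table zero; split=> // s' i c lt_s' lt_i lt_c.
by rewrite table // /halves_done lt_c addn0 addn1.
Qed.

Lemma table_memory_side s m :
  table_memory s (2 ^ half_vars N) 0 m -> table_memory s.+1 0 0 m.
Proof.
case=> masks table zero; split=> // s' i c lt_s' lt_i lt_c.
rewrite table // /halves_done ltnS !addn0.
by case: (ltngtP s' s) => // lt_ss'; case: eqP.
Qed.

Lemma has_tables_end m : table_memory 2 0 0 m -> has_tables m.
Proof. by case=> _ table _ s i c lt_s lt_i lt_c; rewrite table // /halves_done lt_s. Qed.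

Lemma table_memory_store s a c m : s < 2 -> a < 2 ^ half_vars N -> c < M ->
  table_memory s a c m ->
  table_memory s a c.+1 (upd m (table_cell N M s (row_index F s a) c) (half_sat F s a c)).
Proof.
move=> lt_s lt_a lt_c [masks table zero]; have lt_row := row_index_lt F s lt_a.
split=> [d b lt_d|s' i c' lt_s' lt_i lt_c'|b le_b].
- by rewrite upd_other ?masks // /table_cell /table_base; case: b; lia.
- rewrite /upd; case: eqP => [eq_cell|ne_cell].
    have [-> -> ->] := table_cell_inj lt_i lt_row lt_c' lt_c eq_cell.
    by rewrite /halves_done ltnn eqxx ltnSn addn1 rows_upto_index.
  rewrite table // /halves_done; case: (ltngtP s' s) => // def_s.
  rewrite ltnS; case: (ltngtP c' c) => //= def_c.
  rewrite addn0 addn1 rows_uptoS; case: eqP => [def_i|_]; last by rewrite orbF.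
  by case: ne_cell; rewrite -def_i def_c def_s.
- by rewrite upd_other ?zero //; have := table_cell_lt lt_s lt_row lt_c; lia.
Qed.

Definition row_index_steps : nat := if M < half_vars N then M else 0.

Lemma row_index_steps_le : row_index_steps <= M.
Proof. by rewrite /row_index_steps; case: ifP. Qed.

Lemma eval_partial_index rho m s a c :
  s < 2 -> a < 2 ^ half_vars N -> c < row_index_steps -> params rho -> has_masks m ->
  rho Side = s -> rho Half = a -> rho Clause = c ->
  rho Row = partial_index F s a c ->
  eval_expr (2 * Row + sat_expr)%expr rho m = partial_index F s a c.+1.
Proof.
move=> lt_s lt_a lt_c par masks sideE halfE clauseE rowE.
have lt_cM := leq_trans lt_c row_index_steps_le.
have /= -> := eval_sat_expr par masks sideE halfE clauseE lt_a lt_cM.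
by rewrite rowE /partial_index; move: lt_c; rewrite /row_index_steps; case: ifP.
Qed.

Lemma wp_row_index rho m s a : s < 2 -> a < 2 ^ half_vars N -> params rho -> has_masks m ->
  rho Side = s -> rho Half = a ->
  wp row_index_prog rho m (M * 100 + 40) (fun rho' m' =>
    [/\ params rho', keeps [:: Side; Half] rho rho', rho' Row = row_index F s a & m' = m]).
Proof.
move=> lt_s lt_a par masks sideE halfE; have le_steps := row_index_steps_le.
have lt_index c : c <= M -> partial_index F s a c < cell_bound l.
  by move=> le_c; apply: leq_ltn_trans (partial_index_le _ _ _) (param_value_lt NumHalves).
pose I c (rho' : var -> nat) m' := [/\ params rho', rho' Clause = c,
  keeps [:: Side; Half] rho rho', rho' Row = partial_index F s a c & m' = m].
have branchE (x y : nat) : (if (M < half_vars N) == 0 :> nat then y else x) =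
    if M < half_vars N then x else y by case: (M < _).
eapply wp_time.
  eapply wp_seq; apply: wp_assign => //=; rewrite !par halfE /= branchE.
    exact: (lt_index 0).
  apply: (wp_for l_gt0 lw (n := row_index_steps) (I := I) (Tb := fun=> 80)) => //.
  - exact: leq_ltn_trans le_steps (param_value_lt NumClauses).
  - by split=> //; do 2!(apply: keeps_set_var => //).
  - by move=> c rho' m' [par' clause' _ _ _]; rewrite /= !par' branchE.
  - move=> c rho' m' lt_c [par' clause' kept row' ->].
    have lt_cM := leq_trans lt_c le_steps.
    have side' := etrans (kept Side isT) sideE; have half' := etrans (kept Half isT) halfE.
    have indexS := eval_partial_index lt_s lt_a lt_c par' masks side' half' clause' row'.
    apply: (wp_time (T := cost (2 * Row + sat_expr)%expr + 1)) => //.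
    apply: wp_assign; rewrite ?indexS ?lt_index //.
      by split=> //; apply: small_shifts_sat_expr par' side' lt_s.
    by split=> //; split=> //; do 2!(apply: keeps_set_var => //).
  - move=> rho' m' [par' _ kept row' ->]; split=> //.
    by rewrite row' /row_index /partial_index /row_index_steps; case: (M < _).
rewrite sum_nat_const_nat subn0 /=.
by have := leq_mul le_steps (leqnn 92); lia.
Qed.

Lemma wp_table_row rho m s a : s < 2 -> a < 2 ^ half_vars N -> params rho ->
  table_memory s a 0 m -> rho Side = s -> rho Half = a -> rho Row = row_index F s a ->
  wp (For (Clause : var) NumClauses (Store (table_addr Row Clause) sat_expr)) rho m
    (M * 100 + 40) (fun rho' m' =>
      [/\ params rho', keeps [:: Side; Half] rho rho' & table_memory s a M m']).
Proof.
move=> lt_s lt_a par mem_a sideE halfE rowE.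
pose I c (rho' : var -> nat) m' := [/\ params rho', rho' Clause = c,
  keeps [:: Side; Half; Row] rho rho' & table_memory s a c m'].
eapply wp_time.
  apply: (wp_for l_gt0 lw (n := M) (I := I) (Tb := fun=> 80)) => //.
  - exact: (param_value_lt NumClauses).
  - by split=> //; apply: keeps_set_var.
  - by move=> c rho' m' [par' clause' _ _]; split=> //; apply: par'.
  - move=> c rho' m' lt_c [par' clause' kept mem_c]; have [masks _ _] := mem_c.
    have side' := etrans (kept Side isT) sideE; have half' := etrans (kept Half isT) halfE.
    have row' := etrans (kept Row isT) rowE.
    have satE := eval_sat_expr par' masks side' half' clause' lt_a lt_c.
    apply: (wp_time (T := cost (table_addr Row Clause) + (cost sat_expr + 1))) => //.
    apply: wp_store => //.
    + exact: small_shifts_sat_expr par' side' lt_s.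
    + by rewrite satE; apply: leq_ltn_trans (leqW (leq_b1 _)) two_lt_cell_bound.
    + rewrite satE /= !par' side' row' clause' /=; split=> //; split=> //.
        exact: keeps_set_var.
      exact: table_memory_store.
  - by move=> rho' m' [par' _ kept mem']; split=> //; apply: keeps_sub kept.
by rewrite sum_nat_const_nat subn0 /=; lia.
Qed.

Lemma wp_table_half rho m s a : s < 2 -> a < 2 ^ half_vars N -> params rho ->
  table_memory s a 0 m -> rho Side = s -> rho Half = a ->
  wp table_half_prog rho m (M * 200 + 80) (fun rho' m' =>
    [/\ params rho', rho' Side = s, rho' Half = a & table_memory s a.+1 0 m']).
Proof.
move=> lt_s lt_a par mem_a sideE halfE; have [masks _ _] := mem_a; eapply wp_time.
  apply: wp_then (wp_row_index lt_s lt_a par masks sideE halfE) _.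
  move=> rho1 m1 [par1 kept1 row1 ->].
  have side1 := etrans (kept1 Side isT) sideE; have half1 := etrans (kept1 Half isT) halfE.
  apply: wp_weaken (wp_table_row lt_s lt_a par1 mem_a side1 half1 row1) (leqnn _) _.
  move=> rho2 m2 [par2 kept2 mem2]; split=> //.
  - exact: etrans (kept2 Side isT) side1.
  - exact: etrans (kept2 Half isT) half1.
  - exact: table_memory_half.
by lia.
Qed.

Lemma wp_table_side rho m s : s < 2 -> params rho -> table_memory s 0 0 m -> rho Side = s ->
  wp (For (Half : var) NumHalves table_half_prog) rho m
    (2 ^ half_vars N * (M * 200 + 88) + 6) (fun rho' m' =>
    [/\ params rho', rho' Side = s & table_memory s.+1 0 0 m']).
Proof.
move=> lt_s par mem_s sideE.
pose I a (rho' : var -> nat) m' := [/\ params rho', rho' Side = s, rho' Half = a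
  & table_memory s a 0 m'].
eapply wp_time.
  apply: (wp_for l_gt0 lw (n := 2 ^ half_vars N) (I := I) (Tb := fun=> M * 200 + 80)) => //.
  - exact: (param_value_lt NumHalves).
  - by move=> a rho' m' [par' _ half' _]; split=> //; apply: par'.
  - move=> a rho' m' lt_a [par' side' half' mem'].
    apply: wp_weaken (wp_table_half lt_s lt_a par' mem' side' half') (leqnn _) _.
    by move=> rho2 m2 [par2 side2 half2 mem2].
  - by move=> rho' m' [par' side' _ mem']; split=> //; apply: table_memory_side.
by rewrite sum_nat_const_nat subn0 /=; lia.
Qed.

Lemma wp_table rho m : params rho -> table_memory 0 0 0 m ->
  wp table_prog rho m (2 * (2 ^ half_vars N * (M * 200 + 100)) + 60) (fun rho' m' =>
    [/\ params rho', has_tables m' & forall b, instance_base N M <= b -> m' b = 0]).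
Proof.
move=> par mem0.
pose I s (rho' : var -> nat) m' := [/\ params rho', rho' Side = s & table_memory s 0 0 m'].
eapply wp_time.
  apply: (wp_for l_gt0 lw (n := 2) (I := I)
    (Tb := fun=> 2 ^ half_vars N * (M * 200 + 88) + 6)) => //.
  - exact: two_lt_cell_bound.
  - by move=> s rho' m' [].
  - move=> s rho' m' lt_s [par' side' mem'].
    apply: wp_weaken (wp_table_side lt_s par' mem' side') (leqnn _) _.
    by move=> rho2 m2 [par2 side2 mem2].
  - by move=> rho' m' [par' _ mem']; split=> //; [exact: has_tables_end | case: mem'].
by rewrite sum_nat_const_nat subn0 /=; lia.
Qed.

Lemma eval_separator_expr (lv i b : expr var) (rho : var -> nat) m : params rho ->
  eval_expr (separator_expr lv i b) rho m =
  separator_runs (6 * M) k (eval_expr lv rho m) (eval_expr i rho m)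
    (eval_expr b rho m != 0).
Proof.
move=> par; rewrite /= !par /= !shiftlE !mul1n !addn1 /separator_runs.
by case: (eval_expr b rho m).
Qed.

Section RunsExpr.
Variables (rho : var -> nat) (m : nat -> nat) (s i v : nat).
Hypotheses (par : params rho).
Hypotheses (sideE : rho Side = s) (rowE : rho Row = i) (symbolE : rho Symbol = v).
Hypothesis table : forall c, c < M -> m (table_cell N M s i c) = row_table F s i c.

Lemma eval_runs_expr :
  eval_expr runs_expr rho m = side_runs (6 * M) k M (row_table F s) s i v.
Proof.
rewrite /runs_expr; set p := (Symbol %/ 2)%expr; set b := ((Symbol + Side) %% 2)%expr.
have pE : eval_expr p rho m = v %/ 2 by rewrite /= symbolE.
have bE : eval_expr b rho m = odd (v + s) by rewrite /= symbolE sideE modn2.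
have iteE c x y : eval_expr (Ite c x y) rho m =
    if eval_expr c rho m == 0 then eval_expr y rho m else eval_expr x rho m by [].
rewrite !iteE !eval_separator_expr // bE; clearbody p b.
rewrite /= !par rowE sideE !pE /= !addn1 /side_runs /runs.
case: (ltnP (v %/ 2) k) => [_|le_kp] /=; first by case: odd.
case: ltnP => [lt_p|_] /=; last by case: odd.
have := @table (v %/ 2 - k); rewrite /table_cell /clause_runs => ->; last by lia.
by case: odd.
Qed.

Lemma small_shifts_runs_expr : small_shifts l runs_expr rho m.
Proof.
have le_h := half_vars_le N; have le_k := log_rows_le_half N M.
by rewrite /= !par /=; do !split=> //; lia.
Qed.

End RunsExpr.

Local Notation mu s := (side_runs (6 * M) k M (row_table F s) s).
Local Notation V := (alphabet_size k M).

Lemma side_runs_le s i v : mu s i v <= 6 * (M * H) + 3.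
Proof.
have separator_le lv j b : separator_runs (6 * M) k lv j b <= 6 * (M * H) + 3.
  apply: leq_trans (leq_addr _ _); rewrite mulnA leq_mul2l; apply/orP; right.
  have le_r : 2 ^ (k - lv.+1) <= H by rewrite leq_exp2l ?leq_subr.
  by apply: leq_trans le_r; case: b; rewrite -[leqRHS]mul1n leq_mul2r leq_b1 orbT.
rewrite /side_runs /runs; case: ifP => // _; case: ifP => // _.
by apply: leq_trans (leq_addl _ _); rewrite /clause_runs; case: odd; case: row_table.
Qed.

(* What has been written when run [v] of block [i] of side [s] has been emitted up to
   its first [e] symbols. *)
Definition output (s i v e : nat) : seq nat :=
  flatten [seq instance_side F s' | s' <- iota 0 s]
    ++ (block_word i V (mu s) ++ (block v (mu s i) ++ nseq e v)).

Lemma outputS s i v e : output s i v e.+1 = rcons (output s i v e) v.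
Proof. by rewrite /output -[e.+1]addn1 nseqD -cats1 !catA. Qed.

Lemma output_run s i v : output s i v (mu s i v) = output s i v.+1 0.
Proof. by rewrite /output blockS /= cats0. Qed.

Lemma output_block s i : output s i V 0 = output s i.+1 0 0.
Proof. by rewrite /output block_wordS /= !cats0. Qed.

Lemma output_side s : output s H 0 0 = output s.+1 0 0 0.
Proof. by rewrite /output flatten_iotaS /= !cats0. Qed.

Lemma size_instance_side s : size (instance_side F s) = side_size N M.
Proof. exact: size_side_word. Qed.

Lemma size_output_le s i v e : s < 2 -> i < H -> v < V -> e <= mu s i v ->
  size (output s i v e) <= 2 * side_size N M.
Proof.
move=> lt_s lt_i lt_v le_e; apply: (@leq_trans (size (output s H 0 0))).
  apply/size_subseq/cat_subseq => //; rewrite /= cats0.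
  apply: subseq_trans (subseq_flatten_iota _ lt_i : subseq (block_word i.+1 V (mu s)) _).
  rewrite block_wordS; apply: cat_subseq => //.
  apply: subseq_trans (subseq_flatten_iota _ lt_v : subseq (block v.+1 (mu s i)) _).
  by rewrite blockS; apply: cat_subseq => //; apply: subseq_nseq.
rewrite output_side; case: s lt_s {le_e} => [|[|]] // _; rewrite /output /= !cats0.
  by rewrite size_instance_side leq_pmull.
by rewrite size_cat !size_instance_side mul2n addnn.
Qed.

Section Emission.
Variable m0 : nat -> nat.
Hypothesis table : has_tables m0.

Definition emission (s i v e : nat) (rho : var -> nat) (m : nat -> nat) : Prop :=
  [/\ params rho, rho Ptr = instance_base N M + 1 + size (output s i v e),
    forall a, a <= instance_base N M -> m a = m0 a
  & forall z, m (instance_base N M + 1 + z) = nth 0 (output s i v e) z].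

Lemma emissionS s i v e (rho : var -> nat) m : emission s i v e rho m ->
  emission s i v e.+1 (set_var rho (Ptr : var) (rho Ptr + 1)) (upd m (rho Ptr) v).
Proof.
case=> par ptrE low high; rewrite /emission outputS size_rcons /set_var /=; split=> //.
- by rewrite ptrE; lia.
- by move=> a le_a; rewrite upd_other ?low // ptrE; lia.
- move=> z; rewrite ptrE /upd nth_rcons eqn_add2l high; case: ltngtP => // gt_z.
  by rewrite nth_default // ltnW.
Qed.

Lemma wp_emit_run (rho : var -> nat) m s i v : s < 2 -> i < H -> v < V ->
  rho Side = s -> rho Row = i -> rho Symbol = v -> emission s i v 0 rho m ->
  wp emit_run_prog rho m (25 * mu s i v + 300) (fun rho' m' =>
    keeps [:: Side; Row; Symbol] rho rho' /\ emission s i v.+1 0 rho' m').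
Proof.
move=> lt_s lt_i lt_v sideE rowE symbolE em; have [par ptrE low high] := em.
have room := memory_fits lt_Nl lt_Ml.
have table_m c : c < M -> m (table_cell N M s i c) = row_table F s i c.
  by move=> lt_c; rewrite low ?table //; apply/ltnW/table_cell_lt.
have muE := eval_runs_expr par sideE rowE symbolE table_m.
have mu_lt : mu s i v < cell_bound l by have := side_runs_le s i v; lia.
have v_lt : v < cell_bound l := ltn_trans lt_v (param_value_lt AlphabetSize).
eapply wp_time.
  eapply wp_seq; apply: wp_assign; rewrite ?muE //; first exact: small_shifts_runs_expr.
  pose I e (rho' : var -> nat) m' := [/\ emission s i v e rho' m', rho' Count = e,
    rho' Mult = mu s i v & keeps [:: Side; Row; Symbol] rho rho'].
  apply: (wp_for l_gt0 lw (n := mu s i v) (I := I) (Tb := fun=> 8)) => //.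
  - by split=> //; do 2!(apply: keeps_set_var => //).
  - by move=> e rho' m' [_ count' mult' _].
  - move=> e rho' m' lt_e [em' count' mult' kept]; have [_ ptr' _ _] := em'.
    have symbol' := etrans (kept Symbol isT) symbolE.
    have size_lt := size_output_le lt_s lt_i lt_v lt_e.
    rewrite outputS size_rcons in size_lt.
    apply: (wp_time (T := (1 + (1 + 1)) + (3 + 1))) => //.
    apply: wp_seq; apply: wp_store => //=; rewrite ?symbol' //.
    apply: wp_assign => //=; first by rewrite ptr'; lia.
    by have := emissionS em'; split=> //; split=> //; do 2!(apply: keeps_set_var => //).
  - by move=> rho' m' [em' _ _ kept]; rewrite /emission -output_run.
rewrite sum_nat_const_nat subn0 /=; lia.
Qed.

Lemma wp_emit_block (rho : var -> nat) m s i : s < 2 -> i < H ->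
  rho Side = s -> rho Row = i -> emission s i 0 0 rho m ->
  wp (For (Symbol : var) AlphabetSize emit_run_prog) rho m
    (\sum_(0 <= v < V) (25 * mu s i v + 308) + 6) (fun rho' m' =>
    keeps [:: Side; Row] rho rho' /\ emission s i.+1 0 0 rho' m').
Proof.
move=> lt_s lt_i sideE rowE em.
pose I v (rho' : var -> nat) m' :=
  [/\ emission s i v 0 rho' m', rho' Symbol = v & keeps [:: Side; Row] rho rho'].
eapply wp_time.
  apply: (wp_for l_gt0 lw (n := V) (I := I) (Tb := fun v => 25 * mu s i v + 300)) => //.
  - exact: (param_value_lt AlphabetSize).
  - by split=> //; apply: keeps_set_var.
  - by move=> v rho' m' [[par' _ _ _] symbol' _]; split=> //; apply: par'.
  - move=> v rho' m' lt_v [em' symbol' kept].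
    have side' := etrans (kept Side isT) sideE; have row' := etrans (kept Row isT) rowE.
    apply: wp_weaken (wp_emit_run lt_s lt_i lt_v side' row' symbol' em') (leqnn _) _.
    move=> rho2 m2 [kept2 em2]; split; first exact: etrans (kept2 Symbol isT) symbol'.
    split=> //; apply: keeps_set_var => //; apply: keeps_trans kept _.
    exact: keeps_sub kept2.
  - by move=> rho' m' [em' _ kept]; rewrite /emission -output_block.
by rewrite /= (eq_bigr (fun v => 25 * mu s i v + 308)) => [|v _]; lia.
Qed.

Lemma wp_emit_side (rho : var -> nat) m s :
  s < 2 -> rho Side = s -> emission s 0 0 0 rho m ->
  wp (For (Row : var) NumRows (For (Symbol : var) AlphabetSize emit_run_prog)) rho m
    (25 * side_size N M + H * (V * 308 + 20) + 10) (fun rho' m' =>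
    rho' Side = s /\ emission s.+1 0 0 0 rho' m').
Proof.
move=> lt_s sideE em.
pose I i (rho' : var -> nat) m' :=
  [/\ emission s i 0 0 rho' m', rho' Row = i & rho' Side = s].
eapply wp_time.
  apply: (wp_for l_gt0 lw (n := H) (I := I)
    (Tb := fun i => \sum_(0 <= v < V) (25 * mu s i v + 308) + 6)) => //.
  - exact: (param_value_lt NumRows).
  - by move=> i rho' m' [[par' _ _ _] row' _]; split=> //; apply: par'.
  - move=> i rho' m' lt_i [em' row' side'].
    apply: wp_weaken (wp_emit_block lt_s lt_i side' row' em') (leqnn _) _.
    move=> rho2 m2 [kept2 em2]; split; first exact: etrans (kept2 Row isT) row'.
    by split=> //; apply: etrans (kept2 Side isT) side'.
  - by move=> rho' m' [em' _ side']; rewrite /emission -output_side.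
rewrite /= !big_split /= !sum_nat_const_nat !subn0 -(size_instance_side s) size_block_word.
under eq_bigr do rewrite big_split /= sum_nat_const_nat subn0 -big_distrr.
rewrite big_split /= sum_nat_const_nat subn0 -big_distrr /=; lia.
Qed.

End Emission.

Definition has_instance (m : nat -> nat) : Prop := forall z, m (instance_base N M + z) =
  nth 0 (encode_LCWIS (instance_side F 0) (instance_side F 1)) z.

Lemma has_instance_emission m0 rho m : m0 (instance_base N M) = side_size N M ->
  emission m0 2 0 0 0 rho m -> has_instance m.
Proof.
move=> sizeE [_ _ low high] [|z].
  by rewrite addn0 low // sizeE /= size_instance_side.
by have := high z; rewrite -addnA add1n => ->; rewrite /output /= !cats0.
Qed.

Lemma wp_emit rho m : params rho -> has_tables m ->
  (forall b, instance_base N M <= b -> m b = 0) ->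
  wp emit_prog rho m (2 * (25 * side_size N M + H * (V * 308 + 20)) + 100) (fun rho' m' =>
    params rho' /\ has_instance m').
Proof.
move=> par tables zero; have room := memory_fits lt_Nl lt_Ml.
pose m1 := upd m (instance_base N M) (side_size N M).
have tables1 : has_tables m1.
  move=> s i c lt_s lt_i lt_c; rewrite /m1 upd_other ?tables //.
  by have := table_cell_lt lt_s lt_i lt_c; lia.
eapply wp_time.
  eapply wp_seq; apply: wp_store => //=; rewrite !par /= -/(side_size N M); first by lia.
  rewrite -/m1; eapply wp_seq; apply: wp_assign => //=; rewrite !par /=; first by lia.
  pose I s (rho' : var -> nat) m' := emission m1 s 0 0 0 rho' m' /\ rho' Side = s.
  apply: (wp_for l_gt0 lw (n := 2) (I := I)
    (Tb := fun=> 25 * side_size N M + H * (V * 308 + 20) + 10)) => //.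
  - exact: two_lt_cell_bound.
  - split=> //; split=> [//||//|z]; first by rewrite /set_var /= addn0.
    by rewrite nth_nil /m1 upd_other ?zero //; lia.
  - by move=> s rho' m' [_ side'].
  - move=> s rho' m' lt_s [em' side'].
    apply: wp_weaken (wp_emit_side tables1 lt_s side' em') (leqnn _) _.
    by move=> rho2 m2 [side2 em2].
  - move=> rho' m' [em' _]; split; first by case: em'.
    by apply: has_instance_emission em'; rewrite /m1 upd_same.
by rewrite sum_nat_const_nat /=; lia.
Qed.

Lemma wp_build (rho : var -> nat) :
  wp build_prog rho (nth 0 (encode_cnf F)) (build_time N M) (fun rho' m' =>
    [/\ has_instance m', rho' InstanceBase = instance_base N M
       & rho' Offset = 12 * (M * (H - 1))]).
Proof.
have room := memory_fits lt_Nl lt_Ml.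
apply: wp_time (build_time_bound N M).
apply: wp_then (@wp_init rho) _ => rho1 m1 [par1 ->].
apply: wp_then (wp_parse par1) _ => rho2 m2 [par2 masks zero2].
apply: wp_then (wp_table par2 (table_memory0 masks zero2)) _ => rho3 m3 [par3 tables zero3].
apply: wp_then (wp_emit par3 tables zero3) _ => rho4 m4 [par4 inst4].
eapply wp_time.
  apply: wp_assign => //=; rewrite !par4 /=.
    have : 12 * (M * (H - 1)) <= 12 * (M * H) by rewrite !leq_mul2l leq_subr !orbT.
    by lia.
  by split=> //; apply: (par4 InstanceBase).
by [].
Qed.

End Verification.

Definition reduction_prog (p : cmd) : cmd :=
  let K := (max_reg p).+1 in
  Seq (compile K build_prog)
    (Seq (relocate (var_reg K (InstanceBase : var)) (tmp_reg var K) p)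
      (Seq (Op OpSub 0 0 (var_reg K (Offset : var)))
        (Seq (Const (tmp_reg var K) 2) (Op OpDiv 0 0 (tmp_reg var K))))).

Lemma is_LCWIS_length_unique (A B : seq nat) k k' :
  is_LCWIS_length A B k -> is_LCWIS_length A B k' -> k = k'.
Proof.
case=> -[C cC <-] maxC [[D cD <-] maxD]; apply/eqP.
by rewrite eqn_leq maxD ?maxC.
Qed.

Lemma trunc_log_lt X n : 0 < n -> X < 2 ^ n -> trunc_log 2 X < n.
Proof.
move=> n_gt0 lt_X; have [->|X_gt0] := posnP X; first by rewrite trunc_log0.
by rewrite -(ltn_exp2l _ _ (ltnSn 1)); apply: leq_ltn_trans lt_X; apply: trunc_logP.
Qed.

Lemma LCWIS_word_instance c l N (F : cnf N) : N < l -> size F < 2 ^ l ->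
  LCWIS_word c (side_size N (size F)) (instance_side F 0) (instance_side F 1)
    <= c * (l * cell_width).
Proof.
move=> lt_Nl lt_Ml; rewrite leq_mul2l; apply/orP; right; apply: trunc_log_lt.
  by rewrite muln_gt0 (leq_trans _ lt_Nl).
apply: leq_ltn_trans (memory_fits lt_Nl lt_Ml).
have le_kM := log_rows_le_clauses N (size F).
suff : \max_(x <- instance_side F 0 ++ instance_side F 1) x <= 6 * size F by lia.
apply/bigmax_leqP_seq => x; rewrite mem_cat => x_in _.
apply: (@leq_trans (alphabet_size (log_rows N (size F)) (size F))).
  by apply: ltnW; case/orP: x_in => /mem_block_word.
by rewrite /alphabet_size; lia.
Qed.

Lemma exec_half_difference w s b r x : b != 0 -> r != 0 -> r != b ->
  regs s 0 = regs s b + 2 * x -> regs s 0 < 2 ^ w -> 1 < w ->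
  exists2 s', exec w (Seq (Op OpSub 0 0 b) (Seq (Const r 2) (Op OpDiv 0 0 r))) s 3 s' &
    regs s' 0 = x.
Proof.
move=> b0 r0 rb s0 lt_s0 w_gt1; pose s1 := set_reg s 0 (2 * x); pose s2 := set_reg s1 r 2.
exists (set_reg s2 0 x); last exact: upd_same.
have -> : 3 = 1 + (1 + 1) by [].
apply: (ExecSeq (s1 := s1)).
  have := ExecOp (w := w) (o := OpSub) 0 (y := 0) (z := b) (s := s).
  by rewrite /= s0 addKn; apply; lia.
apply: (ExecSeq (s1 := s2)); first by apply: ExecConst; rewrite -{1}[2]expn1 ltn_exp2l.
have := ExecOp (w := w) (o := OpDiv) 0 (y := 0) (z := r) (s := s2).
rewrite /= upd_same upd_other 1?eq_sym // upd_same mulKn //.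
by apply; lia.
Qed.

Section ReductionCorrect.
Variables (p : cmd) (c N : nat) (F : cnf N).
Hypothesis wf_F : wf_cnf F.
Local Notation M := (size F).
Local Notation l := (N + trunc_log 2 M).+1.
Local Notation w := (max_sat_word (c * cell_width + word_width) N M).
Local Notation w0 := (LCWIS_word c (side_size N M) (instance_side F 0) (instance_side F 1)).
Let K := (max_reg p).+1.

Let lt_Nl : N < l. Proof. by rewrite ltnS leq_addr. Qed.

Let lt_Ml : M < 2 ^ l.
Proof.
by apply: leq_trans (trunc_log_ltn M (ltnSn 1)) _; rewrite leq_exp2l // ltnS leq_addl.
Qed.

Let lw : l * word_width <= w.
Proof. by rewrite /max_sat_word mulnDl [l * _]mulnC leq_addl. Qed.

Lemma relocation_room : 2 ^ w0 + instance_base N M <= 2 ^ w.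
Proof.
have base_lt : instance_base N M < cell_bound l by have := memory_fits lt_Nl lt_Ml; lia.
have w0_le := LCWIS_word_instance c lt_Nl lt_Ml.
apply: (@leq_trans (2 ^ (c * (l * cell_width) + l * cell_width).+1)).
  rewrite expnS mul2n -addnn; apply: leq_add.
    by rewrite leq_exp2l // (leq_trans w0_le) // leq_addr.
  by apply: ltnW; apply: leq_trans base_lt _; rewrite leq_exp2l // leq_addl.
by rewrite leq_exp2l // /max_sat_word /cell_width /word_width; nia.
Qed.

Lemma exec_build : exists t s, [/\
  exec w (compile K build_prog) (init_state (encode_cnf F)) t s, t <= build_time N M,
  relocated w0 K (instance_base N M) (var_reg K (InstanceBase : var))
    (init_state (encode_LCWIS (instance_side F 0) (instance_side F 1))) s &
  regs s (var_reg K (Offset : var)) = 12 * (M * (2 ^ log_rows N M - 1))].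
Proof.
have input_ok : represents (V := var) K l (init_state (encode_cnf F))
    (fun=> 0 : nat) (nth 0 (encode_cnf F)).
  by split=> // [x|a]; [rewrite expn_gt0 | apply: encode_cnf_lt].
have [t [s [rho [m [E le_t [Rs Ms zero _ _] [inst base offset]]]]]] :=
  wp_build wf_F lw lt_Nl lt_Ml input_ok.
exists t, s; split=> //; last by rewrite Rs.
split=> [r lt_r|a||r] /=.
- exact: zero.
- by rewrite Ms inst.
- by rewrite Rs.
- by rewrite expn_gt0.
Qed.

Lemma reduction_correct t0 k0 :
  outputs w0 p (encode_LCWIS (instance_side F 0) (instance_side F 1)) t0 k0 ->
  is_LCWIS_length (instance_side F 0) (instance_side F 1) k0 ->
  exists2 t, outputs w (reduction_prog p) (encode_cnf F) t (max_sat F) &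
    t <= build_time N M + (2 * t0 + 3).
Proof.
case=> s0 E0 out0 lcwis0.
have [t1 [s1 [E1 le1 reloc1 offset1]]] := exec_build.
have le_Kvar x : K <= var_reg K (x : var) by apply: leq_addr.
have var_tmp x : var_reg K (x : var) != tmp_reg var K by rewrite ltn_eqF ?var_reg_lt.
have [t2 [s2 [E2 le2 [R2 _ _ lt_s0] keep2]]] := exec_relocate relocation_room
  (le_Kvar _) (leq_addr _ _) (var_tmp _) E0 (ltnSn _) reloc1.
have s2_0 : regs s2 0 = regs s2 (var_reg K (Offset : var)) + 2 * max_sat F.
  rewrite [regs s2 (var_reg _ _)]keep2 ?le_Kvar ?var_tmp // offset1 mulnA R2 // out0.
  exact: is_LCWIS_length_unique lcwis0 (is_LCWIS_length_instance F).
have lt_s2 : regs s2 0 < 2 ^ w.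
  by rewrite R2 //; apply: leq_trans (lt_s0 0) _; have := relocation_room; lia.
have w_gt1 : 1 < w by apply: leq_trans lw; rewrite mulSn /word_width; lia.
have [s3 E3 s3_0] : exists2 s3, exec w (Seq (Op OpSub 0 0 (var_reg K (Offset : var)))
    (Seq (Const (tmp_reg var K) 2) (Op OpDiv 0 0 (tmp_reg var K)))) s2 3 s3
    & regs s3 0 = max_sat F.
  by apply: exec_half_difference => //; rewrite eq_sym var_tmp.
exists (t1 + (t2 + 3)); last by rewrite leq_add // leq_add2r.
by exists s3 => //; apply: ExecSeq E1 (ExecSeq E2 E3).
Qed.

End ReductionCorrect.

(** * Sublinear time is impossible *)

Lemma bigmax_const1 (s : seq nat) : 1 \in s -> all (leq^~ 1) s -> \max_(x <- s) x = 1.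
Proof.
move=> s1 /allP le1; apply/eqP; rewrite eqn_leq; apply/andP; split.
  by apply/bigmax_leqP_seq => x /le1.
exact: (bigop.leq_bigmax_seq (F := id) _ s1).
Qed.

Lemma is_LCWIS_length_self A : sorted leq A -> is_LCWIS_length A A (size A).
Proof.
by move=> sortA; split=> [|C [_ /size_subseq //]]; exists A.
Qed.

Lemma is_LCWIS_length_full (A B : seq nat) :
  size A = size B -> is_LCWIS_length A B (size A) -> A = B.
Proof.
move=> eq_size [[C [_ subA subB] size_C] _].
have /eqP <- : C == A by rewrite -(size_subseq_leqif subA) size_C.
by apply/eqP; rewrite -(size_subseq_leqif subB) size_C eq_size.
Qed.

Lemma unread_cell (S : seq nat) n : size S < n -> exists2 i, i < n & i.+1 \notin S.
Proof.
move=> lt_S; apply: contrapT => all_read; suff : n <= size S by lia.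
rewrite -(size_iota 1 n); apply: uniq_leq_size; first exact: iota_uniq.
move=> x; rewrite mem_iota add1n ltnS => /andP[x_gt0 le_x].
apply: contrapT => /negP unread_x; apply: all_read; exists x.-1; first by lia.
by rewrite prednK.
Qed.

Lemma nth_encode_LCWIS_set (A B : seq nat) i v a : i < size A -> a != i.+1 ->
  nth 0 (encode_LCWIS (set_nth 0 A i v) B) a = nth 0 (encode_LCWIS A B) a.
Proof.
move=> lt_i ne_a; have size_A' : size (set_nth 0 A i v) = size A.
  by rewrite size_set_nth (maxn_idPr lt_i).
case: a ne_a => [|a] /= ne_a; first exact: size_A'.
by rewrite !nth_cat size_A' nth_set_nth /=; move: ne_a; rewrite eqSS => /negbTE ->.
Qed.

(* If a cell of [A = 1^n] is not read, changing it to 0 goes unnoticed although the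
   answer drops below [n]. *)
Lemma LCWIS_time_linear (R : realType) (T : nat -> R) : LCWIS_algorithm T ->
  forall n, 2 <= n -> (n%:R <= T n)%R.
Proof.
case=> p [c alg] n n_ge2; pose A := nseq n 1.
have size_A : size A = n by rewrite size_nseq.
have sortA : sorted leq A by rewrite /A; elim: (n) => // -[|m] //= ->.
have [t [k [[s E out] lcwis le_tT]]] := alg n A A size_A size_A.
apply: le_trans le_tT; rewrite ler_nat leqNgt; apply/negP => lt_tn.
have k_n : k = n.
  by rewrite -size_A; apply: is_LCWIS_length_unique lcwis (is_LCWIS_length_self sortA).
have [S le_S run] := exec_local E.
have [i lt_i unread_i] := unread_cell (leq_ltn_trans le_S lt_tn).
pose A' := set_nth 0 A i 0.
have size_A' : size A' = n by rewrite size_set_nth size_A (maxn_idPr lt_i).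
have [|m' E' _] := run (nth 0 (encode_LCWIS A' A)).
  move=> a Sa; rewrite nth_encode_LCWIS_set ?size_A //.
  by apply: contraNneq unread_i => <-.
have [t' [k' [[s' E'' out'] lcwis' _]]] := alg n A' A size_A' size_A.
have same_word : LCWIS_word c n A' A = LCWIS_word c n A A.
  have A1 : 1 \in A by rewrite mem_nseq eqxx andbT; lia.
  have leA : all (leq^~ 1) A by rewrite all_nseq orbT.
  have leA' : all (leq^~ 1) A'.
    apply/(all_nthP 0) => x; rewrite size_A' nth_set_nth /= => lt_x.
    by case: eqP => // _; rewrite nth_nseq lt_x.
  by rewrite /LCWIS_word !bigmax_const1 ?all_cat ?mem_cat ?A1 ?leA ?leA' ?orbT.
rewrite same_word in E''; have [_ eq_s] := exec_deterministic E'' E'.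
have k'_n : k' = size A' by rewrite size_A' -out' eq_s /= out.
have : nth 0 A' i = nth 0 A i.
  by rewrite (@is_LCWIS_length_full A' A) ?size_A // -k'_n.
by rewrite nth_set_nth /= eqxx nth_nseq lt_i.
Qed.

(** * The running time *)

Local Open Scope classical_set_scope.
Local Open Scope ring_scope.

Section Growth.
Variables (R : realType) (eps : R) (T : nat -> R).
Hypothesis T_O : T =O_\oo (fun n : nat => n%:R `^ (2 - eps)).

Lemma bigO_bound : exists2 C : R, 0 < C &
  exists n0, forall n, (n0 <= n)%N -> T n <= C * n%:R `^ (2 - eps).
Proof.
move: T_O => /eqO_exP[C C_gt0 [n0 _ T_le]]; exists C => //; exists n0 => n le_n.
apply: le_trans (ler_norm _) _; apply: le_trans (T_le n le_n) _.
by rewrite ger0_norm // powR_ge0.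
Qed.

Lemma bigO_sublinear : 1 < eps -> exists2 n, (2 <= n)%N & T n < n%:R.
Proof.
move=> eps_gt1; have [C C_gt0 [n0 T_le]] := bigO_bound.
have e_gt0 : 0 < eps - 1 by rewrite subr_gt0.
pose n := maxn n0 (maxn 2 (Num.truncn (C `^ (eps - 1)^-1)).+1).
exists n; first by rewrite !leq_max leqnn orbT.
have lt_n : C `^ (eps - 1)^-1 < n%:R.
  by apply: lt_le_trans (truncnS_gt _) _; rewrite ler_nat !leq_max leqnn !orbT.
have n_gt0 : 0 < n%:R :> R by apply: le_lt_trans lt_n; apply: powR_ge0.
apply: le_lt_trans (T_le n _) _; first by rewrite leq_maxl.
have C_lt : C < n%:R `^ (eps - 1).
  have -> : C = (C `^ (eps - 1)^-1) `^ (eps - 1).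
    by rewrite -powRrM mulVf ?powRr1 ?ltW //; apply: lt0r_neq0.
  by apply: gt0_ltr_powR => //; rewrite nnegrE ?powR_ge0 // ltW.
have split_n : n%:R `^ (eps - 1) * n%:R `^ (2 - eps) = n%:R :> R.
  rewrite -powRD; last by rewrite (gt_eqF n_gt0) implybT.
  by rewrite (_ : eps - 1 + (2 - eps) = 1) ?powRr1 ?ltW //; ring.
by rewrite -[ltRHS]split_n ltr_pM2r // powR_gt0.
Qed.

Lemma bigO_uniform : eps <= 2 -> exists2 C : R, 0 < C &
  forall n, T n <= C * n.+1%:R `^ (2 - eps).
Proof.
move=> eps_le2; have [C C_gt0 [n0 T_le]] := bigO_bound.
exists (C + \sum_(i < n0) `|T i|); first by rewrite ltr_pwDl // sumr_ge0.
move=> n; rewrite mulrDl.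
have pow_ge1 : 1 <= n.+1%:R `^ (2 - eps) :> R.
  by rewrite -[leLHS](powRr0 n.+1%:R) ler_powR ?ler1n // subr_ge0.
have [le_n|lt_n] := leqP n0 n.
  apply: le_trans (T_le n le_n) _; rewrite -[leLHS]addr0 lerD //.
    by rewrite ler_pM2l // ge0_ler_powR ?nnegrE ?ler_nat // subr_ge0.
  by rewrite mulr_ge0 ?powR_ge0 ?sumr_ge0.
apply: le_trans (ler_norm _) _; rewrite -[leLHS]add0r lerD //.
  by rewrite mulr_ge0 ?powR_ge0 // ltW.
apply: (@le_trans _ _ (\sum_(i < n0) `|T i|)); last by rewrite ler_peMr // sumr_ge0.
by rewrite (bigD1 (Ordinal lt_n)) //= lerDl sumr_ge0.
Qed.

End Growth.

Section TimeBound.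
Variables (R : realType) (eps C : R) (N M : nat).
Hypotheses (eps_gt0 : 0 < eps) (eps_le1 : eps <= 1) (C_gt0 : 0 < C).
Local Notation Z := (@powR R 2 (N%:R / 2)).
Local Notation Y := (@powR R 2 ((1 - eps / 2) * N%:R)).

Let exponent_ge0 : 0 <= 2 - eps.
Proof. by rewrite subr_ge0 (le_trans eps_le1) // ler1n. Qed.

Lemma pow_half_vars_le : (2 ^ half_vars N)%N%:R <= 2 * Z.
Proof.
rewrite natrX -powR_mulrn // -[X in X * _]powRr1 // -powRD ?pnatr_eq0 ?implybT //.
apply: ler_powR; first by rewrite ler1n.
have : (2 * half_vars N <= N + 1)%N by rewrite /half_vars; lia.
by rewrite -(ler_nat R) natrM natrD; lra.
Qed.

Lemma half_power_le : Z <= Y.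
Proof.
apply: ler_powR; first by rewrite ler1n.
have : 0 <= N%:R * (1 - eps) by rewrite mulr_ge0 // subr_ge0.
by lra.
Qed.

Lemma powR_subquadratic_le (x a : R) : 0 <= x -> 1 <= a -> x <= a * Z ->
  x `^ (2 - eps) <= a ^+ 2 * Y.
Proof.
move=> x_ge0 a_ge1 x_le; have a_ge0 : 0 <= a by lra.
apply: (@le_trans _ _ ((a * Z) `^ (2 - eps))).
  by apply: (ge0_ler_powR exponent_ge0); rewrite ?nnegrE ?mulr_ge0 ?powR_ge0.
rewrite powRM ?powR_ge0 // (_ : Z `^ (2 - eps) = Y).
  by rewrite ler_wpM2r ?powR_ge0 // -powR_mulrn // ler_powR // lerBlDr lerDl ltW.
by rewrite -powRrM; congr (_ `^ _); field.
Qed.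

Lemma succ_side_size_le : (side_size N M).+1%:R <= 44 * M.+1%:R ^+ 2 * Z.
Proof.
have : ((side_size N M).+1 <= 22 * (M.+1 ^ 2 * 2 ^ half_vars N))%N.
  have := side_size_le N M; have : (0 < M.+1 ^ 2 * 2 ^ half_vars N)%N.
    by rewrite muln_gt0 !expn_gt0.
  by lia.
rewrite -(ler_nat R) 2!natrM [(M.+1 ^ 2)%:R]natrX => /le_trans; apply.
have -> : 44 * M.+1%:R ^+ 2 * Z = 22 * (M.+1%:R ^+ 2 * (2 * Z)) by ring.
by rewrite !ler_wpM2l ?exprn_ge0 // pow_half_vars_le.
Qed.

Definition time_poly : {poly R} :=
  (2 * C * 44 ^+ 2) *: ('X + 1%:P) ^+ 4 + (2 * (100 * 100 + 3)) *: ('X + 1%:P) ^+ 2.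

Lemma time_poly_bound (t t0 : nat) :
  t0%:R <= C * (side_size N M).+1%:R `^ (2 - eps) ->
  (t <= build_time N M + (2 * t0 + 3))%N -> t%:R <= Y * time_poly.[M%:R].
Proof.
move=> t0_le t_le; set m : R := M%:R + 1; have mE : m = M.+1%:R by rewrite -natr1.
have m_ge1 : 1 <= m by rewrite mE ler1n.
set P := ((2 ^ half_vars N)%N%:R : R).
have P_ge1 : 1 <= P by rewrite ler1n expn_gt0.
have P_le : P <= 2 * Y by have := pow_half_vars_le; have := half_power_le; rewrite -/P; lra.
have m2_ge1 : 1 <= m ^+ 2 by rewrite exprn_ege1.
have m2P_le : m ^+ 2 * P <= m ^+ 2 * (2 * Y) by rewrite ler_wpM2l //; lra.
have T_le : t0%:R <= C * ((44 * m ^+ 2) ^+ 2 * Y).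
  apply: le_trans t0_le _; rewrite ler_pM2l //; apply: powR_subquadratic_le => //.
    by rewrite mulr_ege1 // ler1n.
  by rewrite mE; apply: succ_side_size_le.
have t_leR : t%:R <= 100 * (100 * (m ^+ 2 * P)) + (2 * t0%:R + 3).
  move: t_le; rewrite /build_time -(ler_nat R) natrD (natrM _ 100) (natrM _ 100).
  by rewrite (natrM _ (M.+1 ^ 2)) [(M.+1 ^ 2)%:R]natrX (natrD _ (2 * t0)) (natrM _ 2) -mE.
rewrite hornerD !hornerZ !horner_exp !hornerD hornerX hornerC -/m.
have -> : Y * (2 * C * 44 ^+ 2 * m ^+ 4 + 2 * (100 * 100 + 3) * m ^+ 2) =
  2 * (C * ((44 * m ^+ 2) ^+ 2 * Y)) + (100 * 100 + 3) * (m ^+ 2 * (2 * Y)) by ring.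
have m2P_ge1 : 1 <= m ^+ 2 * P by rewrite mulr_ege1.
by lra.
Qed.

End TimeBound.

Theorem theorem1 (R : realType) (eps : R) (eps_gt0 : 0 < eps) :
  (exists2 T : nat -> R,
      T =O_\oo (fun n : nat => n%:R `^ (2 - eps)) & LCWIS_algorithm T) ->
  exists p : {poly R},
    MAX_CNF_SAT_algorithm
      (fun N M : nat => 2 `^ ((1 - eps / 2) * N%:R) * p.[M%:R]).
Proof.
case=> T T_O alg.
have [eps_gt1|eps_le1] := ltP 1 eps.
  have [n n_ge2] := bigO_sublinear T_O eps_gt1.
  by rewrite ltNge (LCWIS_time_linear alg).
have [|C C_gt0 T_le] := bigO_uniform T_O; first by rewrite (le_trans eps_le1) // ler1n.
case: alg => p [c alg].
exists (time_poly C), (reduction_prog p), (c * cell_width + word_width)%N.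
move=> N M F wf_F <-.
have [t0 [k0 [out0 lcwis0 t0_le]]] := alg (side_size N (size F))
  (instance_side F 0) (instance_side F 1) (size_instance_side F 0) (size_instance_side F 1).
have [t out t_le] := reduction_correct wf_F out0 lcwis0.
exists t; split=> //.
by apply: time_poly_bound t_le => //; apply: le_trans t0_le (T_le _).
Qed.
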